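(* Let $R>1$, let $d\ge 1$ be an integer, and let $A\in\mathbb{C}^{d\times d}$ be an invertible matrix satisfying $\|A\|<R$ and $\|A^{-1}\|<R$. Then $$K(A,R)\;\le\; 1+\sqrt{1+\frac{2}{R^2+1}}.$$
   Context: For $R>1$, let $\mathcal{A}_R=\{z\in\mathbb{C} : R^{-1}<|z|<R\}$ be the open annulus. $\mathbb{C}^d$ carries the Euclidean inner product $\langle\cdot,\cdot\rangle$ and its norm $\|\cdot\|$; for a matrix $A\in\mathbb{C}^{d\times d}$, $\|A\|=\max\{\|Au\| : u\in\mathbb{C}^d,\ \|u\|\le 1\}$ is the operator norm. For a matrix $A$ whose spectrum is contained in $\mathcal{A}_R$, $K(A,R)$ denotes the smallest constant $K$ such that $\|f(A)\|\le K$ for all rational functions $f$ bounded by $1$ in $\mathcal{A}_R$ (that is, $|f(z)|\le 1$ for all $z\in\mathcal{A}_R$). The hypotheses $\|A\|<R$ and $\|A^{-1}\|<R$ imply that the spectrum of $A$ is contained in $\mathcal{A}_R$. *)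

(* Defs.v *)
From mathcomp Require Import all_boot all_order all_algebra.
From mathcomp Require Import spectral complex.
From mathcomp Require Import boolp classical_sets reals constructive_ereal ereal.

Set Implicit Arguments.
Unset Strict Implicit.
Unset Printing Implicit Defensive.

Import Order.TTheory GRing.Theory Num.Theory.

Local Open Scope classical_set_scope.
Local Open Scope ring_scope.
Local Open Scope complex_scope.

(* The complex numbers are R[i], for R the real numbers.  The order of R[i]
   relates only numbers with equal imaginary parts, so on moduli it is the
   order of R. *)

Definition annulus (R : realType) (r : R) : set R[i] :=
  [set z | r^-1%:C < `|z| < r%:C].

(* [dotmx] is the library's Hermitian inner product, on row vectors. *)
Definition inner (R : realType) (d : nat) (u v : 'cV[R[i]]_d) : R[i] :=
  dotmx u^T v^T.

(* [inner u u] is a nonnegative real number, so taking its real part only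
   changes its type. *)
Definition enorm (R : realType) (d : nat) (u : 'cV[R[i]]_d) : R :=
  Num.sqrt (complex.Re (inner u u)).

(* The set is nonempty and compact, hence this supremum is a maximum. *)
Definition opnorm (R : realType) (d : nat) (A : 'M[R[i]]_d) : R :=
  sup [set enorm (A *m u) | u in [set u : 'cV[R[i]]_d | enorm u <= 1]].

(* f(A) for the rational function f = p / q.  If q vanishes nowhere on the
   spectrum of A then q(A) is invertible and f(A) depends on f only. *)
Definition ratfun_mx (R : realType) (d : nat) (p q : {poly R[i]})
    (A : 'M[R[i]]_d.+1) : 'M[R[i]]_d.+1 :=
  horner_mx A p *m invmx (horner_mx A q).

(* A rational function bounded on the annulus has no pole there, so it is a
   quotient p / q with q nonvanishing on the annulus. *)
Definition ratfun_bounded_by1 (R : realType) (r : R) (p q : {poly R[i]}) : Prop :=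
  forall z : R[i], annulus r z -> q.[z] != 0 /\ `|p.[z] / q.[z]| <= 1.

Definition spectral_constants (R : realType) (d : nat) (A : 'M[R[i]]_d.+1)
    (r : R) : set R :=
  [set K : R | forall p q : {poly R[i]}, ratfun_bounded_by1 r p q ->
     opnorm (ratfun_mx p q A) <= K].

(* The least admissible constant, for A with spectrum in the annulus; it is
   taken in \bar R so that it is +oo if no constant is admissible. *)
Definition Kconst (R : realType) (d : nat) (A : 'M[R[i]]_d.+1) (r : R) : \bar R :=
  ereal_inf [set K%:E | K in spectral_constants A r].

(* Main.v *)
Require Import Defs.
From HB Require Import structures.
From mathcomp Require Import all_boot all_order all_algebra.
From mathcomp Require Import cyclic spectral separable cyclotomic complex.
From mathcomp Require Import boolp classical_sets reals ereal.
From mathcomp Require Import ring lra.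

Set Implicit Arguments.
Unset Strict Implicit.
Unset Printing Implicit Defensive.

Import Order.TTheory GRing.Theory Num.Theory.

Local Open Scope ring_scope.

Local Notation "x %:C" := (real_complex _ x) (format "x %:C") : ring_scope.
Local Notation Re := complex.Re.
Local Notation "A ^H" := (map_mx Num.conj A^T) (at level 30) : ring_scope.

(** Let [s] be slightly smaller than [r], with [mnorm A] and [mnorm A^-1] below
    [s], and let [K] be the supremum of [mnorm f(A)] over the Laurent
    polynomials [f] of modulus at most [1] on the two circles of radii [s] and
    [s^-1].  With [f = sum a_n z^n], put [rho = s^-2],
    [gap = 2 rho / (1 + rho)] and

      [g = gap a_0^* + sum over n <> 0 of a_n^* rho^|n| z^-n].

    The sum [f(A) + g(A)^H + (1 - gap) a_0] is the harmonic functional calculus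
    of the contraction [A / s] applied to [f] on the outer circle, plus that of
    [A^-1 / s] applied to [f] on the inner one ([hcalc_annulus]).  By von
    Neumann's inequality for trigonometric polynomials ([hcalc_contraction]),
    each of them has norm at most [1], and the sum has norm at most [2].  On
    one circle, [g] is the conjugate of the convolution of [f] on the other
    circle with the Poisson kernel of parameter [rho] minus its minimum
    [1 - gap]; this positive kernel has mass [gap], hence [|g| <= gap]
    ([bounded_reflection]).

    If [f] and a unit vector [x] were extremal, with [f(A) x = K y] and [y] a
    unit vector, then [f(A)^H y = K x], and, when [K > 1], composing [f] with
    small disk automorphisms would show that [x] and [y] are orthogonal.  This
    removes the term [(1 - gap) a_0], and

      [K = <f(A) x, y> <= 2 + |<x, g(A) y>|
         = 2 + |<y, (f g f)(A) x>| / K^2 <= 2 + gap / K],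

    that is, [K (K - 2) <= gap = 2 / (s^2 + 1)].  Extremal pairs are replaced
    by near-extremal ones, with explicit errors ([near_orthogonal],
    [near_extremal_bound], [Klaurent_quadratic]); that [K] is finite is
    [lev_bounded].  A rational function [p / q] is replaced by the Laurent
    polynomial [p l], where [l] is a Laurent polynomial such that [q l] is close
    to [1] on the circles ([mnorm_ratfun_le]), and finally [s] tends to [r].  *)

(** * Moduli, Euclidean norms and operator norms *)

(** The modulus as an element of [R].  This definition and the next three are
    locked because unification would otherwise compare two norms by unfolding
    both to sums over coordinates. *)
HB.lock Definition cmod (R : realType) (z : R[i]) : R := Re `|z|.

HB.lock Definition idot (R : realType) d (x y : 'cV[R[i]]_d) : R[i] := inner x y.

HB.lock Definition vnorm (R : realType) d (x : 'cV[R[i]]_d) : R := enorm x.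

HB.lock Definition mnorm (R : realType) d (A : 'M[R[i]]_d) : R := opnorm A.

Section Modulus.
Context {R : realType}.
Local Notation C := R[i].
Implicit Types (z w : C) (a b : R).

Let cmod_def z : cmod z = Re `|z|. Proof. by rewrite unlock. Qed.

Lemma cmodE z : (cmod z)%:C = `|z|.
Proof. by rewrite unlock; apply/RRe_real/normr_real. Qed.

Lemma cmod_le z a : (cmod z <= a) = (`|z| <= a%:C).
Proof. by rewrite -cmodE lecR. Qed.

Lemma cmod_ge0 z : 0 <= cmod z.
Proof. by rewrite -ler0c cmodE normr_ge0. Qed.

Lemma cmodM z w : cmod (z * w) = cmod z * cmod w.
Proof. by apply/complexI; rewrite rmorphM /= !cmodE normrM. Qed.

Lemma cmodD z w : cmod (z + w) <= cmod z + cmod w.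
Proof. by rewrite cmod_le rmorphD /= !cmodE ler_normD. Qed.

Lemma cmodN z : cmod (- z) = cmod z.
Proof. by rewrite !cmod_def normrN. Qed.

Lemma cmodB z w : cmod (z - w) <= cmod z + cmod w.
Proof. by rewrite -(cmodN w) cmodD. Qed.

Lemma cmod_conj z : cmod z^* = cmod z.
Proof. by rewrite !cmod_def norm_conjC. Qed.

Lemma cmodR a : cmod a%:C = `|a|.
Proof. by rewrite cmod_def normc_def /= expr0n addr0 sqrtr_sqr. Qed.

Lemma cmod0 : cmod (0 : C) = 0. Proof. by rewrite cmod_def normr0. Qed.
Lemma cmod1 : cmod (1 : C) = 1. Proof. by rewrite cmod_def normr1. Qed.

Lemma cmod_eq0 z : (cmod z == 0) = (z == 0).
Proof. by rewrite -[z == 0]normr_eq0 -cmodE (inj_eq (@complexI _)). Qed.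

Lemma cmodV z : cmod z^-1 = (cmod z)^-1.
Proof. by apply/complexI; rewrite fmorphV /= !cmodE normfV. Qed.

Lemma cmodX z n : cmod (z ^+ n) = cmod z ^+ n.
Proof. by apply/complexI; rewrite rmorphXn /= !cmodE normrX. Qed.

Lemma cmod_sum I (r : seq I) (F : I -> C) :
  cmod (\sum_(i <- r) F i) <= \sum_(i <- r) cmod (F i).
Proof.
elim/big_ind2: _ => [|x1 x2 y1 y2 h1 h2|//]; first by rewrite cmod0.
exact: le_trans (cmodD _ _) (lerD h1 h2).
Qed.

Lemma Re_le_cmod z : Re z <= cmod z.
Proof.
rewrite -lecR cmodE; apply: le_trans (normc_ge_Re z).
by rewrite lecR ler_norm.
Qed.

Lemma ReD z w : Re (z + w) = Re z + Re w. Proof. by case: z w => ? ? []. Qed.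
Lemma ReN z : Re (- z) = - Re z. Proof. by case: z. Qed.
Lemma ReB z w : Re (z - w) = Re z - Re w. Proof. by rewrite ReD ReN. Qed.
Lemma ReZ a z : Re (a%:C * z) = a * Re z.
Proof. by case: z => x y /=; rewrite mul0r subr0. Qed.
Lemma Re_sum I (r : seq I) (F : I -> C) :
  Re (\sum_(i <- r) F i) = \sum_(i <- r) Re (F i).
Proof. by elim/big_ind2: _ => // x1 x2 y1 y2 <- <-; rewrite ReD. Qed.

Lemma mul_conj z : z * z^* = (cmod z ^+ 2)%:C.
Proof. by rewrite -normCK rmorphXn /= cmodE. Qed.

Lemma conj_real a : (a%:C)^* = a%:C :> C.
Proof. exact: conjc_real. Qed.

Lemma Re_conj z : Re (z^* : C) = Re z.
Proof. by case: z. Qed.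

Lemma phaseP z : exists2 u, cmod u = 1 & u * z = (cmod z)%:C.
Proof.
have [->|z0] := eqVneq z 0; first by exists 1; rewrite ?cmod1 // mulr0 cmod0.
have cz : cmod z != 0 by rewrite cmod_eq0.
exists (z^* / (cmod z)%:C).
  by rewrite cmodM cmodV cmodR cmod_conj ger0_norm ?cmod_ge0 // divff.
rewrite mulrAC [z^* * z]mulrC mul_conj -fmorphV -rmorphM /=.
by rewrite expr2 mulfK.
Qed.

End Modulus.

Section Inner.
Context {R : realType} {d : nat}.
Local Notation C := R[i].
Implicit Types (x y z u v : 'cV[C]_d) (a b : C).

Lemma idotE x y : idot x y = \sum_i x i 0 * (y i 0)^*.
Proof. by rewrite unlock /inner dotmxE mxE; apply: eq_bigr => i _; rewrite !mxE. Qed.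

Lemma idotDl x y z : idot (x + y) z = idot x z + idot y z.
Proof. by rewrite !idotE -big_split /=; apply: eq_bigr => i _; rewrite mxE mulrDl. Qed.

Lemma idotZl a x y : idot (a *: x) y = a * idot x y.
Proof. by rewrite !idotE big_distrr /=; apply: eq_bigr => i _; rewrite mxE mulrA. Qed.

Lemma idot_conj x y : (idot x y)^* = idot y x.
Proof.
rewrite !idotE rmorph_sum; apply: eq_bigr => i _.
by rewrite rmorphM /= conjCK mulrC.
Qed.

Lemma idotDr x y z : idot x (y + z) = idot x y + idot x z.
Proof. by rewrite -idot_conj idotDl rmorphD /= !idot_conj. Qed.

Lemma idotZr a x y : idot x (a *: y) = a^* * idot x y.
Proof. by rewrite -idot_conj idotZl rmorphM /= idot_conj. Qed.

Lemma idotNl x y : idot (- x) y = - idot x y.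
Proof. by rewrite -scaleN1r idotZl mulN1r. Qed.
Lemma idotNr x y : idot x (- y) = - idot x y.
Proof. by rewrite -idot_conj idotNl rmorphN /= idot_conj. Qed.
Lemma idotBl x y z : idot (x - y) z = idot x z - idot y z.
Proof. by rewrite idotDl idotNl. Qed.
Lemma idotBr x y z : idot x (y - z) = idot x y - idot x z.
Proof. by rewrite idotDr idotNr. Qed.
Lemma idot0l y : idot 0 y = 0.
Proof. by rewrite -(scale0r y) idotZl mul0r. Qed.

Lemma idot_suml I (r : seq I) (F : I -> 'cV[C]_d) y :
  idot (\sum_(i <- r) F i) y = \sum_(i <- r) idot (F i) y.
Proof.
by elim/big_ind2: _ => [|x1 x2 y1 y2 <- <-|//]; rewrite ?idot0l ?idotDl.
Qed.

Lemma idot_adj (A : 'M[C]_d) x y : idot (A *m x) y = idot x (A^H *m y).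
Proof.
rewrite !idotE; under eq_bigr do rewrite mxE mulr_suml.
rewrite exchange_big; apply: eq_bigr => j _ /=.
rewrite mxE rmorph_sum mulr_sumr; apply: eq_bigr => i _ /=.
by rewrite !mxE rmorphM /= conjCK [A i j * _]mulrC mulrA.
Qed.

Lemma vnorm_ge0 x : 0 <= vnorm x. Proof. by rewrite unlock sqrtr_ge0. Qed.

Lemma idot_ge0 x : 0 <= idot x x.
Proof. by rewrite idotE sumr_ge0 // => i _; rewrite mul_conjC_ge0. Qed.

Lemma vnormE x : idot x x = (vnorm x ^+ 2)%:C.
Proof.
have h := idot_ge0 x; rewrite [vnorm]unlock /enorm.
have -> : inner x x = idot x x by rewrite unlock.
rewrite sqr_sqrtr; first by rewrite RRe_real // ger0_real.
by move: h; rewrite lecE => /andP[].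
Qed.

Lemma vnorm_sqr x : vnorm x ^+ 2 = Re (idot x x).
Proof. by rewrite vnormE. Qed.

Lemma vnorm0 : vnorm (0 : 'cV[C]_d) = 0.
Proof. by apply/eqP; rewrite -sqrf_eq0 vnorm_sqr idot0l. Qed.

Lemma vnorm_eq0 x : (vnorm x == 0) = (x == 0).
Proof.
apply/eqP/eqP => [h|->]; last exact: vnorm0.
apply/eqP; rewrite -trmx_eq0 -(dnorm_eq0 (@dotmx C d)).
by have := vnormE x; rewrite h expr0n unlock /inner => /= ->.
Qed.

Lemma vnormZ a x : vnorm (a *: x) = cmod a * vnorm x.
Proof.
apply/eqP; rewrite -(eqrXn2 (n := 2)) ?mulr_ge0 ?vnorm_ge0 ?cmod_ge0 //.
apply/eqP/complexI; rewrite -vnormE idotZl idotZr exprMn rmorphM /=.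
by rewrite -vnormE mulrA mul_conj.
Qed.

Lemma Cauchy_Schwarz x y : cmod (idot x y) <= vnorm x * vnorm y.
Proof.
rewrite -(ler_pXn2r (n := 2)) ?nnegrE ?mulr_ge0 ?vnorm_ge0 ?cmod_ge0 //.
have : `|idot x y| ^+ 2 <= idot x x * idot y y.
  rewrite unlock; exact: (CauchySchwarz (@dotmx C d) x^T y^T).1.
by rewrite !vnormE -rmorphM -exprMn -cmodE -rmorphXn lecR.
Qed.

Lemma vnorm_sqrD x y :
  vnorm (x + y) ^+ 2 = vnorm x ^+ 2 + 2 * Re (idot x y) + vnorm y ^+ 2.
Proof.
rewrite (vnorm_sqr (x + y)) (vnorm_sqr x) (vnorm_sqr y).
rewrite idotDl.
rewrite !idotDr.
rewrite !ReD.
rewrite -[idot y x]idot_conj.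
rewrite Re_conj.
ring.
Qed.

Lemma vnormD x y : vnorm (x + y) <= vnorm x + vnorm y.
Proof.
rewrite -(ler_pXn2r (n := 2)) ?nnegrE ?addr_ge0 ?vnorm_ge0 //.
rewrite vnorm_sqrD.
have := le_trans (Re_le_cmod _) (Cauchy_Schwarz x y).
by rewrite sqrrD mulr_natl => h; rewrite lerD2r lerD2l ler_wMn2r.
Qed.

Lemma vnormN x : vnorm (- x) = vnorm x.
Proof. by rewrite -scaleN1r vnormZ cmodN cmod1 mul1r. Qed.

Lemma vnorm_sum I (r : seq I) (F : I -> 'cV[C]_d) :
  vnorm (\sum_(i <- r) F i) <= \sum_(i <- r) vnorm (F i).
Proof.
elim/big_ind2: _ => [|x1 x2 y1 y2 h1 h2|//]; first by rewrite vnorm0.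
exact: le_trans (vnormD _ _) (lerD h1 h2).
Qed.

(** Reduces homogeneous inequalities to the unit ball; at [x = 0] any vector of
    the ball would do. *)
Lemma unit_scaling x : exists2 u, vnorm u <= 1 & x = (vnorm x)%:C *: u.
Proof.
have [->|x0] := eqVneq x 0; first by exists 0; rewrite ?vnorm0 ?scaler0.
have nx : vnorm x != 0 by rewrite vnorm_eq0.
exists ((vnorm x)^-1%:C *: x); last first.
  by rewrite scalerA -rmorphM divff // scale1r.
by rewrite vnormZ cmodR ger0_norm ?invr_ge0 ?vnorm_ge0 // mulVf.
Qed.

End Inner.

Section OperatorNorm.
Context {R : realType} {d : nat}.
Local Notation C := R[i].
Implicit Types (A B : 'M[C]_d) (x y : 'cV[C]_d) (a : C) (c : R).

Local Notation opset A :=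
  [set vnorm (A *m u) | u in [set u : 'cV[C]_d | vnorm u <= 1]]%classic.

Lemma vnorm_mulmx_bounded A : exists c, forall x, vnorm (A *m x) <= c * vnorm x.
Proof.
exists (\sum_j vnorm (col j A)) => x.
have -> : A *m x = \sum_j x j 0 *: col j A.
  apply/matrixP=> i k; rewrite !mxE summxE; apply: eq_bigr => j _.
  by rewrite !mxE ord1 mulrC.
apply: le_trans (vnorm_sum _ _) _; rewrite mulr_suml ler_sum // => j _.
rewrite vnormZ mulrC ler_wpM2l ?vnorm_ge0 //.
rewrite -(ler_pXn2r (n := 2)) ?nnegrE ?vnorm_ge0 ?cmod_ge0 //.
rewrite vnorm_sqr idotE Re_sum (bigD1 j) //= mul_conj lerDl.
by apply: sumr_ge0 => i _; rewrite mul_conj /= exprn_ge0 ?cmod_ge0.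
Qed.

Lemma mnorm_sup A : mnorm A = sup (opset A).
Proof. by rewrite [@mnorm]unlock [@vnorm]unlock. Qed.

Lemma opset_has_sup A : has_sup (opset A).
Proof.
split; first by exists (vnorm (A *m 0)), 0 => //=; rewrite vnorm0.
have [c hc] := vnorm_mulmx_bounded A; exists `|c| => _ [u /= u1 <-].
apply: le_trans (hc u) _; apply: le_trans (ler_norm _) _.
by rewrite normrM ler_piMr // ger0_norm ?vnorm_ge0.
Qed.

Lemma mnorm_ge0 A : 0 <= mnorm A.
Proof.
rewrite mnorm_sup; apply: le_trans (sup_upper_bound (opset_has_sup A) _); last first.
  by exists 0; rewrite //= vnorm0.
exact: vnorm_ge0.
Qed.

Lemma le_mnorm A x : vnorm (A *m x) <= mnorm A * vnorm x.
Proof.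
have [u u1 {1}->] := unit_scaling x.
rewrite -scalemxAr vnormZ cmodR ger0_norm ?vnorm_ge0 // mulrC.
rewrite ler_wpM2r ?vnorm_ge0 //.
by rewrite mnorm_sup; apply: (sup_upper_bound (opset_has_sup A)); exists u.
Qed.

Lemma mnorm_le A c : 0 <= c -> (forall x, vnorm (A *m x) <= c * vnorm x) ->
  mnorm A <= c.
Proof.
move=> c0 h; rewrite mnorm_sup; apply: ge_sup; first by case: (opset_has_sup A).
by move=> _ [u /= u1 <-]; rewrite (le_trans (h u)) // ler_piMr.
Qed.

Lemma mnorm_near A c : c < mnorm A -> exists2 x, vnorm x <= 1 & c < vnorm (A *m x).
Proof.
rewrite mnorm_sup -subr_gt0 => h.
have [_ [u /= u1 <-] hu] := sup_adherent h (opset_has_sup A).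
by exists u => //; move: hu; rewrite opprB addrC subrK.
Qed.

Lemma cmod_idot_le A x y :
  cmod (idot (A *m x) y) <= mnorm A * vnorm x * vnorm y.
Proof.
apply: le_trans (Cauchy_Schwarz _ _) _.
by rewrite ler_wpM2r ?vnorm_ge0 ?le_mnorm.
Qed.

Lemma mnorm_le_idot A c :
  (forall x y, vnorm x <= 1 -> vnorm y <= 1 -> cmod (idot (A *m x) y) <= c) ->
  mnorm A <= c.
Proof.
move=> h; have c0 : 0 <= c.
  by apply: le_trans (cmod_ge0 _) (h 0 0 _ _); rewrite vnorm0.
apply: mnorm_le => // x; have [u u1 {1}->] := unit_scaling x.
rewrite -scalemxAr vnormZ cmodR ger0_norm ?vnorm_ge0 // mulrC.
rewrite ler_wpM2r ?vnorm_ge0 //.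
have [y y1 ey] := unit_scaling (A *m u).
have := h u y u1 y1; rewrite {1}ey idotZl cmodM cmodR ger0_norm ?vnorm_ge0 //.
have [->//|n0] := eqVneq (vnorm (A *m u)) 0.
have /eqP : vnorm (A *m u) = vnorm (A *m u) * vnorm y.
  by rewrite {1}ey vnormZ cmodR ger0_norm ?vnorm_ge0.
rewrite -{1}[vnorm _]mulr1 (inj_eq (mulfI n0)) => /eqP ny.
by rewrite vnormE -ny expr1n cmod1 mulr1.
Qed.

Lemma mnormM A B : mnorm (A *m B) <= mnorm A * mnorm B.
Proof.
apply: mnorm_le => [|x]; first by rewrite mulr_ge0 ?mnorm_ge0.
rewrite -mulmxA (le_trans (le_mnorm _ _)) // -mulrA.
by rewrite ler_wpM2l ?mnorm_ge0 ?le_mnorm.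
Qed.

Lemma mnormD A B : mnorm (A + B) <= mnorm A + mnorm B.
Proof.
apply: mnorm_le => [|x]; first by rewrite addr_ge0 ?mnorm_ge0.
by rewrite mulmxDl mulrDl (le_trans (vnormD _ _)) // lerD ?le_mnorm.
Qed.

Lemma mnorm0 : mnorm (0 : 'M[C]_d) = 0.
Proof.
apply/eqP; rewrite eq_le mnorm_ge0 andbT.
by apply: mnorm_le => // x; rewrite mul0mx vnorm0 mul0r.
Qed.

Lemma mnormZ_le a A : mnorm (a *: A) <= cmod a * mnorm A.
Proof.
apply: mnorm_le => [|x]; first by rewrite mulr_ge0 ?mnorm_ge0 ?cmod_ge0.
by rewrite -scalemxAl vnormZ -mulrA ler_wpM2l ?cmod_ge0 ?le_mnorm.
Qed.

Lemma mnormN A : mnorm (- A) = mnorm A.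
Proof.
have h B : mnorm (- B) <= mnorm B.
  by rewrite -scaleN1r (le_trans (mnormZ_le _ _)) // cmodN cmod1 mul1r.
by apply/eqP; rewrite eq_le h -{1}[A]opprK h.
Qed.

Lemma mnormB A B : mnorm (A - B) <= mnorm A + mnorm B.
Proof. by rewrite -(mnormN B) mnormD. Qed.

Lemma mnorm_adj A : mnorm (A^H) = mnorm A.
Proof.
have h B : mnorm (B^H) <= mnorm B.
  apply: mnorm_le_idot => x y x1 y1.
  rewrite idot_adj trmxCK -idot_conj cmod_conj.
  apply: le_trans (cmod_idot_le _ _ _) _.
  by rewrite -mulrA ler_piMr ?mnorm_ge0 // mulr_ile1 ?vnorm_ge0.
by apply/eqP; rewrite eq_le h -{1}[A]trmxCK h.
Qed.

Lemma mnorm_sum I (r : seq I) (F : I -> 'M[C]_d) :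
  mnorm (\sum_(i <- r) F i) <= \sum_(i <- r) mnorm (F i).
Proof.
elim/big_ind2: _ => [|x1 x2 y1 y2 h1 h2|//]; first by rewrite mnorm0.
exact: le_trans (mnormD _ _) (lerD h1 h2).
Qed.

Lemma mnorm1_le : mnorm (1%:M : 'M[C]_d) <= 1.
Proof. by apply: mnorm_le => // x; rewrite mul1mx mul1r. Qed.

End OperatorNorm.

Lemma mnormX (R : realType) d (A : 'M[R[i]]_d.+1) n :
  mnorm (A ^+ n) <= mnorm A ^+ n.
Proof.
elim: n => [|n IH]; first by rewrite !expr0 mnorm1_le.
rewrite !exprS; apply: le_trans (mnormM _ _) _.
by rewrite ler_wpM2l ?mnorm_ge0.
Qed.

(** If [A v = 0] then [(A - 1) v = - v], which has the norm of [v]. *)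
Lemma unitmx_near1 (R : realType) d (A : 'M[R[i]]_d.+1) :
  mnorm (A - 1) < 1 -> A \in unitmx.
Proof.
move=> h; rewrite -unitmx_tr -row_free_unit; apply/row_freeP.
apply/row_freeP/inj_row_free => v.
move=> /(congr1 trmx); rewrite trmx_mul trmxK trmx0 => hv.
apply/eqP; rewrite -trmx_eq0 -vnorm_eq0 eq_le vnorm_ge0 andbT leNgt.
apply/negP => n0; have := le_mnorm (A - 1) v^T.
rewrite mulmxBl hv mul1mx sub0r vnormN leNgt => /negP; apply.
by rewrite -subr_gt0 -[X in X - _]mul1r -mulrBl mulr_gt0 // subr_gt0.
Qed.

(** * Laurent polynomials *)

Section Adjoint.
Context {R : realType} {d : nat}.
Local Notation C := R[i].
Implicit Types (A B : 'M[C]_d).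

Lemma ctrK A : A^H^H = A.
Proof. exact: trmxCK. Qed.

Lemma ctrM A B : (A *m B)^H = B^H *m A^H.
Proof. by rewrite trmx_mul map_mxM. Qed.

Lemma ctrD A B : (A + B)^H = A^H + B^H.
Proof. by rewrite linearD /= map_mxD. Qed.

Lemma ctrN A : (- A)^H = - A^H.
Proof. by rewrite linearN /= map_mxN. Qed.

Lemma ctrZ (a : C) A : (a *: A)^H = a^* *: A^H.
Proof. by rewrite linearZ /= map_mxZ. Qed.

Lemma ctr1 : (1%:M : 'M[C]_d)^H = 1%:M.
Proof. by rewrite trmx1 map_mx1. Qed.

Lemma ctr0 : (0 : 'M[C]_d)^H = 0.
Proof. by rewrite trmx0 map_mx0. Qed.

Lemma ctr_sum I (r : seq I) (F : I -> 'M[C]_d) :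
  (\sum_(i <- r) F i)^H = \sum_(i <- r) (F i)^H.
Proof. by elim/big_ind2: _ => [|x1 x2 y1 y2 <- <-|//]; rewrite ?ctr0 ?ctrD. Qed.

End Adjoint.

Lemma ctrX (R : realType) d (A : 'M[R[i]]_d.+1) n : (A ^+ n)^H = A^H ^+ n.
Proof.
elim: n => [|n IH]; first by rewrite !expr0; exact: ctr1.
by rewrite exprS exprSr -IH; exact: ctrM.
Qed.

Section Laurent.
Context {R : realType}.
Local Notation C := R[i].
Local Notation laurent := (seq (C * int)).

(** Laurent polynomials are lists of pairs of a coefficient and an exponent,
    possibly with repeated exponents, so that all the operations below are maps
    over lists. *)
Definition lev (U : unitAlgType C) (x : U) (f : laurent) : U :=
  \sum_(t <- f) t.1 *: x ^ t.2.

Definition lmul (f g : laurent) : laurent :=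
  [seq (s.1 * t.1, s.2 + t.2) | s <- f, t <- g].

Definition lscale (c : C) (f : laurent) : laurent :=
  [seq (c * t.1, t.2) | t <- f].

Definition lconst (c : C) : laurent := [:: (c, 0)].

Lemma lev_mul (U : unitAlgType C) (x : U) f g : x \is a GRing.unit ->
  lev x (lmul f g) = lev x f * lev x g.
Proof.
move=> ux; rewrite /lev /lmul big_allpairs_dep mulr_suml.
apply: eq_bigr => s _; rewrite mulr_sumr; apply: eq_bigr => t _ /=.
by rewrite exprzDr // -scalerAl -scalerAr scalerA.
Qed.

Lemma lev_cat (U : unitAlgType C) (x : U) f g :
  lev x (f ++ g) = lev x f + lev x g.
Proof. exact: big_cat. Qed.

Lemma lev_scale (U : unitAlgType C) (x : U) c f :
  lev x (lscale c f) = c *: lev x f.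
Proof.
by rewrite /lev big_map scaler_sumr; apply: eq_bigr => t _; rewrite scalerA.
Qed.

Lemma lev_const (U : unitAlgType C) (x : U) c : lev x (lconst c) = c%:A.
Proof. by rewrite /lev big_seq1 expr0z. Qed.

(** Evaluation at a number, stated with products rather than with the scalings
    of [lev]. *)
Definition lval (z : C) (f : laurent) : C := \sum_(t <- f) t.1 * z ^ t.2.

Let lvalE z f : lval z f = lev (z : C^o) f. Proof. by []. Qed.

Lemma lval_cat (z : C) f g : lval z (f ++ g) = lval z f + lval z g.
Proof. exact: big_cat. Qed.

Lemma lval_const (z a : C) : lval z (lconst a) = a.
Proof. by rewrite /lval big_seq1 expr0z mulr1. Qed.

Lemma lval_scale (z a : C) f : lval z (lscale a f) = a * lval z f.
Proof. by rewrite !lvalE lev_scale. Qed.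

Lemma lval_mul (z : C) f g : z != 0 -> lval z (lmul f g) = lval z f * lval z g.
Proof. by move=> z0; rewrite !lvalE lev_mul // unitfE. Qed.

Definition ldilate (u : C) f : laurent := [seq (t.1 * u ^ t.2, t.2) | t <- f].

Definition lflip f : laurent := [seq (t.1, - t.2) | t <- f].

Lemma lval_dilate u z f : lval z (ldilate u f) = lval (u * z) f.
Proof.
by rewrite /lval big_map; apply: eq_bigr => t _; rewrite /= expfzMl mulrA.
Qed.

Lemma lval_flip z f : lval z (lflip f) = lval z^-1 f.
Proof.
by rewrite /lval big_map; apply: eq_bigr => t _; rewrite /= exprz_inv.
Qed.

Lemma conj_exprz (z : C) (n : int) : (z ^ n)^* = z^* ^ n.
Proof.
by case: n => n; rewrite ?NegzE -?exprz_inv -?exprnP ?rmorphXn //= fmorphV.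
Qed.

End Laurent.

(** * Von Neumann's inequality for trigonometric polynomials *)

Section RootsOfUnity.
Context {R : realType}.
Local Notation C := R[i].

Lemma prim_root_complex N : (0 < N)%N -> {z : C | N.-primitive_root z}.
Proof.
pose p : {poly C} := 'X^N - 1; have [r Dp] := closed_field_poly_normal p.
move=> N_gt0; apply/sigW; rewrite (monicP _) ?monicXnsubC // scale1r in Dp.
have rn1 : all N.-unity_root r by apply/allP=> z; rewrite -root_prod_XsubC -Dp.
have sz_r : (N < (size r).+1)%N.
  by rewrite -(size_prod_XsubC r id) -Dp size_XnsubC.
have [|z] := hasP (has_prim_root N_gt0 rn1 _ sz_r); last by exists z.
by rewrite -separable_prod_XsubC -Dp separable_Xn_sub_1 // pnatr_eq0 -lt0n.
Qed.

Lemma cmod_unity (z : C) N : (0 < N)%N -> z ^+ N = 1 -> cmod z = 1.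
Proof.
move=> N0 h; apply/eqP; rewrite -(pexpr_eq1 N0) ?cmod_ge0 //.
by rewrite -cmodX h cmod1.
Qed.

Lemma cmod1_conj (z : C) : cmod z = 1 -> z^* = z^-1.
Proof.
move=> h; have z0 : z != 0 by rewrite -cmod_eq0 h oner_eq0.
by apply: (mulfI z0); rewrite mul_conj h expr1n divff.
Qed.

Lemma sum_prim_root N (w : C) p k : N.-primitive_root w ->
  (p < N)%N -> (k < N)%N ->
  \sum_(j < N) (w ^+ j) ^ p%:Z * (w ^+ j)^-1 ^+ k = (N * (p == k))%:R.
Proof.
move=> pw pN kN; have w0 : w != 0.
  by apply/eqP => e; have := prim_expr_order pw; rewrite e expr0n;
     case: (N) pN => //= _ _ /eqP; rewrite eq_sym oner_eq0.
pose q := w ^+ p / w ^+ k.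
transitivity (\sum_(j < N) q ^+ j).
  apply: eq_bigr => j _.
  by rewrite /q exprMn -exprnP !exprVn [(w ^+ p) ^+ j]exprAC [(w ^+ k) ^+ j]exprAC.
have [epk|npk] := eqVneq p k.
  rewrite muln1 /q epk divff ?expf_neq0 //; under eq_bigr do rewrite expr1n.
  by rewrite sumr_const card_ord.
have q1 : q - 1 != 0.
  rewrite subr_eq0; apply: contra npk => /eqP qe.
  have : w ^+ p == w ^+ k.
    by rewrite -[w ^+ p](divfK (expf_neq0 k w0)) -/q qe mul1r.
  by rewrite (eq_prim_root_expr pw) !modn_small.
rewrite muln0; apply: (mulfI q1); rewrite mulr0 -subrX1.
rewrite /q exprMn exprVn [(w ^+ p) ^+ N]exprAC [(w ^+ k) ^+ N]exprAC.
by rewrite (prim_expr_order pw) !expr1n divr1 subrr.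
Qed.

End RootsOfUnity.

Section HarmonicCalculus.
Context {R : realType} {d : nat}.
Local Notation C := R[i].
Local Notation M := 'M[C]_d.+1.
Local Notation laurent := (seq (C * int)).
Implicit Types (T : M) (f : laurent) (x y : 'cV[C]_d.+1).

(** The moments of a dilation: if [T] is the compression of a unitary [U], then
    [hpow T n] is the compression of [U ^ n] for every integer [n]. *)
Definition hpow T (n : int) : M :=
  match n with Posz k => T ^+ k | Negz k => T^H ^+ k.+1 end.

Lemma hpowN T n : hpow T (- n) = (hpow T n)^H.
Proof.
case: n => [[|k]|k] /=; first by rewrite !expr0 -idmxE ctr1.
  by rewrite ctrX.
by rewrite -ctrX ctrK.
Qed.

Definition hcalc T f : M := \sum_(t <- f) t.1 *: hpow T t.2.

(** Weaker than [mnorm T < 1]: it also covers the rank one operator of norm [1]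
    that represents the kernel of [weight_bound]. *)
Definition powers_vanish T :=
  forall e : R, 0 < e -> exists N0, forall N, (N0 <= N)%N -> mnorm (T ^+ N) <= e.

Variable T : M.
Hypothesis T1 : mnorm T <= 1.

Section Kernel.
Variables (N : nat) (w : C).
Hypothesis pw : N.-primitive_root w.

Let N0 : (0 < N)%N. Proof. exact: prim_order_gt0 pw. Qed.
Let node (j : nat) := w ^+ j.

Let node1 j : node j ^+ N = 1.
Proof. by rewrite /node -exprM mulnC exprM (prim_expr_order pw) expr1n. Qed.

Let cnode j : cmod (node j) = 1. Proof. exact: cmod_unity N0 (node1 j). Qed.

Let node0 j : node j != 0. Proof. by rewrite -cmod_eq0 cnode oner_eq0. Qed.

Let NC0 : N%:R != 0 :> C. Proof. by rewrite pnatr_eq0 -lt0n. Qed.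

(** Up to the factor [1 - T ^+ N], the resolvent [(1 - T / z)^-1] at the node
    [z = w ^+ j]. *)
Definition resolvent_sum (j : nat) : M := \sum_(k < N) (w ^+ j)^-1 ^+ k *: T ^+ k.

Local Notation B := resolvent_sum.

Let E : M := 1 - T ^+ N.

Lemma resolvent_sumE j : T *m B j = node j *: (B j - E).
Proof.
have h : (node j)^-1 *: (T *m B j) = B j - E.
  have -> : B j = \sum_(k < N) ((node j)^-1 *: T) ^+ k.
    by apply: eq_bigr => k _; rewrite exprZn.
  rewrite scalemxAl -[_ *m _]/(_ * _).
  have := subrX1 ((node j)^-1 *: T) N.
  rewrite exprZn exprVn node1 invr1 scale1r mulrBl mul1r /E => h.
  by rewrite opprB addrC h subrK.
by rewrite -h scalerA divff ?scale1r.
Qed.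

(** Up to factors tending to [1] with [N], the operator Poisson kernel
    [(1 - T / z)^-H (1 - T^H T) (1 - T / z)^-1] at the node [z = w ^+ j].  This
    form is linear in the resolvents, so its moments are those of [B]; the
    positive factored form is [poissonE]. *)
Definition poisson (j : nat) : M := (B j)^H *m E + E^H *m B j - E^H *m E.

(** The identity [T B = z (B - E)] turns the kernel into
    [B^H B - (T B)^H (T B)]. *)
Lemma poissonE j x y : idot (poisson j *m x) y =
  idot (B j *m x) (B j *m y) - idot (T *m (B j *m x)) (T *m (B j *m y)).
Proof.
have -> : poisson j = (B j)^H *m B j - (T *m B j)^H *m (T *m B j).
  rewrite resolvent_sumE ctrZ -scalemxAl -scalemxAr scalerA mulrC.
  rewrite mul_conj cnode expr1n scale1r /poisson; move: E => F.
  rewrite ctrD ctrN mulmxBl !mulmxBr.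
  by apply/matrixP => i k; rewrite !mxE; ring.
by rewrite mulmxBl idotBl -!mulmxA !idot_adj !ctrK !mulmxA.
Qed.

Lemma poisson_ge0 j x : 0 <= Re (idot (poisson j *m x) x).
Proof.
rewrite poissonE ReB -!vnorm_sqr subr_ge0 ler_pXn2r ?nnegrE ?vnorm_ge0 //.
apply: le_trans (le_mnorm _ _) _.
by rewrite ler_piMl ?vnorm_ge0.
Qed.

(** Cauchy-Schwarz for the positive semidefinite form of the kernel, in its
    arithmetic-mean version. *)
Lemma poisson_CS j x y : 2 * cmod (idot (poisson j *m x) y) <=
  Re (idot (poisson j *m x) x) + Re (idot (poisson j *m y) y).
Proof.
have [u u1 hu] := phaseP (idot (poisson j *m x) y).
have := poisson_ge0 j (u *: x - y).
rewrite mulmxBr -scalemxAr !idotBl !idotBr !idotZl !idotZr !ReB hu.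
have -> : Re (u^* * idot (poisson j *m y) x) = cmod (idot (poisson j *m x) y).
  have -> : idot (poisson j *m y) x = (idot (poisson j *m x) y)^*.
    by rewrite !poissonE rmorphB /= !idot_conj.
  by rewrite -rmorphM /= hu.
rewrite mulrA mul_conj u1 expr1n mul1r /=; lra.
Qed.

Definition avg (F : nat -> M) : M := N%:R^-1 *: \sum_(j < N) F j.

(** Averaging over the [N]-th roots of unity selects the exponents congruent to
    [p] modulo [N], and the sum [B] contains a single one. *)
Lemma avg_resolvent n p : (p < N)%N -> w ^ n = w ^+ p ->
  avg (fun j => node j ^ n *: B j) = T ^+ p.
Proof.
move=> pN hn; rewrite /avg /B.
under eq_bigr => j _.
  have -> : node j ^ n = node j ^ p%:Z.
    by rewrite /node -!exprnP !exprnP exprzAC hn -exprnP exprAC.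
  rewrite scaler_sumr; under eq_bigr do rewrite scalerA; over.
rewrite exchange_big /=; under eq_bigr do rewrite -scaler_suml sum_prim_root //.
rewrite (bigD1 (Ordinal pN)) //= eqxx muln1 big1 ?addr0 => [|k].
  by rewrite scalerA mulVf // scale1r.
by rewrite -val_eqE eq_sym /= => /negPf ->; rewrite muln0 scale0r.
Qed.

Let conj_node j (n : int) : (node j ^ n)^* = node j ^ (- n).
Proof.
rewrite -exprz_inv -cmod1_conj ?cnode //.
by case: n => n; rewrite ?NegzE -?exprz_inv /= ?rmorphXn // fmorphV rmorphXn.
Qed.

Lemma avg_poisson (n : int) : avg (fun j => node j ^ n *: poisson j) =
  (avg (fun j => node j ^ (- n) *: B j))^H *m E
  + E^H *m avg (fun j => node j ^ n *: B j)
  - (N%:R^-1 * \sum_(j < N) node j ^ n) *: (E^H *m E).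
Proof.
rewrite /avg /poisson; under eq_bigr do rewrite scalerBr scalerDr.
rewrite sumrB big_split /= scalerBr scalerDr; congr (_ + _ - _).
- rewrite ctrZ fmorphV rmorph_nat -scalemxAl; congr (_ *: _).
  rewrite ctr_sum mulmx_suml; apply: eq_bigr => j _.
  by rewrite ctrZ conj_node opprK -scalemxAl.
- rewrite -scalemxAr; congr (_ *: _).
  by rewrite mulmx_sumr; apply: eq_bigr => j _; rewrite -scalemxAr.
- by rewrite -scaler_suml scalerA.
Qed.

Lemma avg_poisson0 : avg poisson = 1 - (T ^+ N)^H *m T ^+ N.
Proof.
have -> : avg poisson = avg (fun j => node j ^ (0 : int) *: poisson j).
  by rewrite /avg; under [in RHS]eq_bigr do rewrite expr0z scale1r.
have h : avg (fun j => node j ^ (0 : int) *: B j) = 1.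
  by rewrite (@avg_resolvent 0 0) ?expr0.
rewrite avg_poisson oppr0 h.
under eq_bigr do rewrite expr0z.
rewrite sumr_const card_ord mulVf // scale1r /E -idmxE ctr1 mul1mx mulmx1.
rewrite ctrD ctrN ctr1 mulmxBl !mulmxBr !mul1mx !mulmx1.
by apply/matrixP => i k; rewrite !mxE; ring.
Qed.

Lemma avg_poisson_gt0 p : (0 < p)%N -> (p < N)%N ->
  avg (fun j => node j ^ p *: poisson j) =
  T ^+ p + ((T ^+ (N - p))^H *m E - (T ^+ N)^H *m T ^+ p).
Proof.
move=> p0 pN; rewrite avg_poisson (@avg_resolvent p p) //.
rewrite (@avg_resolvent (- p%:Z) (N - p)); last first.
- have w0 : w != 0 by rewrite -[w]expr1 (node0 1).
  have /(mulfI (expf_neq0 p w0)) // : w ^+ p * w ^ (- p%:Z) = w ^+ p * w ^+ (N - p).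
  rewrite -exprz_inv -exprnP exprVn divff ?expf_neq0 // -exprD subnKC ?(prim_expr_order pw) //.
  exact: ltnW.
- by rewrite ltn_subrL p0.
have -> : \sum_(j < N) node j ^ p = 0.
  have := sum_prim_root pw pN N0; under eq_bigr do rewrite expr0 mulr1.
  by move=> ->; rewrite -[p == 0%N]negbK -lt0n p0 muln0.
rewrite mulr0 scale0r subr0 {2}/E ctrD ctrN -idmxE ctr1 mulmxBl mul1mx.
by rewrite addrC -addrA; congr (_ + _); rewrite addrC.
Qed.

Let poisson_ctr j : (poisson j)^H = poisson j.
Proof. by rewrite /poisson ctrD ctrN ctrD !ctrM !ctrK [_ + E^H *m _]addrC. Qed.

Lemma avg_poissonN n : avg (fun j => node j ^ (- n) *: poisson j) =
  (avg (fun j => node j ^ n *: poisson j))^H.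
Proof.
rewrite /avg ctrZ fmorphV rmorph_nat ctr_sum; congr (_ *: _).
by apply: eq_bigr => j _; rewrite ctrZ conj_node poisson_ctr.
Qed.

(** The spurious terms come from aliasing: they contain a power of [T] of
    exponent at least [N - `|n|]. *)
Lemma avg_poisson_hpow e (n : int) : (`|n| < N)%N ->
  (forall m, (N - `|n| <= m)%N -> mnorm (T ^+ m) <= e) ->
  mnorm (avg (fun j => node j ^ n *: poisson j) - hpow T n) <= 3 * e.
Proof.
have X1 m : mnorm (T ^+ m) <= 1.
  by apply: le_trans (mnormX _ _) _; rewrite exprn_ile1 ?mnorm_ge0.
have pos p : (p < N)%N ->
    (forall m, (N - p <= m)%N -> mnorm (T ^+ m) <= e) ->
    mnorm (avg (fun j => node j ^ p%:Z *: poisson j) - hpow T p) <= 3 * e.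
  move=> pN he; have e0 : 0 <= e := le_trans (mnorm_ge0 _) (he _ (leqnn _)).
  have heN : mnorm (T ^+ N) <= e by apply: he; rewrite leq_subr.
  have bnd (a b c g : R) : 0 <= a -> 0 <= b -> a <= e -> c <= e -> b <= 2 ->
    g <= 1 -> 0 <= g -> 0 <= c -> a * b + c * g <= 3 * e by nra.
  have [->|p0] := posnP p.
    have -> : avg (fun j => node j ^ (0 : int) *: poisson j) = avg poisson.
      by rewrite /avg; under eq_bigr do rewrite expr0z scale1r.
    rewrite avg_poisson0 /= expr0 addrAC subrr sub0r mnormN.
    apply: le_trans (mnormM _ _) _; rewrite mnorm_adj.
    have := bnd 0 0 (mnorm (T ^+ N)) (mnorm (T ^+ N)).
    rewrite mul0r add0r; apply; rewrite ?mnorm_ge0 //; lra.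
  rewrite avg_poisson_gt0 //= addrC addKr.
  apply: le_trans (mnormB _ _) _.
  apply: le_trans (lerD (mnormM _ _) (mnormM _ _)) _; rewrite !mnorm_adj.
  apply: bnd; rewrite ?mnorm_ge0 ?he ?leq_subr //.
  apply: le_trans (mnormB _ _) _; rewrite -[2]/(1 + 1) lerD //.
  by rewrite -idmxE mnorm1_le.
case: n => [p|p] /=; first exact: pos.
move=> pN he; rewrite NegzE avg_poissonN -[_ ^+ _]/(hpow T (- p.+1%:Z)) hpowN.
by rewrite -ctrN -ctrD mnorm_adj; apply: pos.
Qed.

Lemma avg_poisson_form x : vnorm x <= 1 ->
  N%:R^-1 * \sum_(j < N) Re (idot (poisson j *m x) x) <= 1.
Proof.
move=> x1; have -> : N%:R^-1 * \sum_(j < N) Re (idot (poisson j *m x) x) =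
    Re (idot (avg poisson *m x) x).
  rewrite /avg -scalemxAl idotZl mulmx_suml idot_suml.
  by rewrite -(rmorph_nat (real_complex R)) -fmorphV /= ReZ Re_sum.
rewrite avg_poisson0 mulmxBl idotBl -idmxE mul1mx -mulmxA idot_adj ctrK ReB.
rewrite -!vnorm_sqr; have := vnorm_ge0 x; have := sqr_ge0 (vnorm (T ^+ N *m x)).
nra.
Qed.

Lemma avg_poisson_bound (h : nat -> C) c x y :
  (forall j, cmod (h j) <= c) -> vnorm x <= 1 -> vnorm y <= 1 ->
  cmod (idot (avg (fun j => h j *: poisson j) *m x) y) <= c.
Proof.
move=> hc x1 y1; have c0 : 0 <= c := le_trans (cmod_ge0 _) (hc 0%N).
have NR0 : 0 < N%:R^-1 :> R by rewrite invr_gt0 ltr0n.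
rewrite /avg -scalemxAl idotZl mulmx_suml idot_suml cmodM.
have -> : cmod N%:R^-1 = N%:R^-1 :> R.
  by rewrite -(rmorph_nat (real_complex R)) -fmorphV /= cmodR gtr0_norm.
apply: le_trans (_ : N%:R^-1 * \sum_(j < N) c / 2 *
    (Re (idot (poisson j *m x) x) + Re (idot (poisson j *m y) y)) <= _).
  rewrite ler_pM2l //; apply: le_trans (cmod_sum _ _) _; apply: ler_sum => j _.
  rewrite -scalemxAl idotZl cmodM.
  apply: le_trans (ler_wpM2r (cmod_ge0 _) (hc j)) _.
  by rewrite -mulrA ler_wpM2l // ler_pdivlMl // poisson_CS.
rewrite -mulr_sumr big_split /= mulrCA mulrDr.
have := avg_poisson_form x1; have := avg_poisson_form y1; nra.
Qed.

End Kernel.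

(** Von Neumann's inequality for trigonometric polynomials: the averages of [f]
    against the positive kernel, of total mass at most [1], are bounded by [c]
    and converge to [hcalc T f] as the number of nodes grows. *)
Lemma hcalc_contraction f c : powers_vanish T ->
  (forall z : C, cmod z = 1 -> cmod (lval z f) <= c) -> mnorm (hcalc T f) <= c.
Proof.
move=> vT hf; apply: mnorm_le_idot => x y x1 y1; apply/ler_addgt0Pr => e e0.
pose S := \sum_(t <- f) cmod t.1.
have S0 : 0 <= S by apply: sumr_ge0 => t _; apply: cmod_ge0.
(* The tolerance on the moments; adding 1 covers the case of a zero [f]. *)
pose dl := e / (3 * S + 1).
have dl0 : 0 < dl by rewrite divr_gt0 //; lra.
have dlE : dl * (3 * S + 1) = e by rewrite divfK //; lra.
have [N0 hN0] := vT dl dl0.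
pose m0 := \max_(t <- f) `|t.2|%N; pose N := (N0 + m0).+1.
have [w pw] := @prim_root_complex R N (ltn0Sn _).
pose P := avg N (fun j => lval (w ^+ j) f *: poisson N w j).
have PE : P = \sum_(t <- f) t.1 *: avg N (fun j => (w ^+ j) ^ t.2 *: poisson N w j).
  rewrite /P /avg; under eq_bigr do rewrite /lval scaler_suml.
  rewrite exchange_big scaler_sumr; apply: eq_bigr => t _ /=.
  rewrite scalerA mulrC -scalerA; congr (_ *: _); rewrite scaler_sumr.
  by apply: eq_bigr => j _; rewrite scalerA.
have diff : mnorm (hcalc T f - P) <= 3 * dl * S.
  rewrite PE /hcalc -sumrB; apply: le_trans (mnorm_sum _ _) _.
  rewrite /S mulr_sumr !big_seq; apply: ler_sum => t tf.
  have tm : (`|t.2| <= m0)%N by apply: leq_bigmax_seq.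
  rewrite -scalerBr; apply: le_trans (mnormZ_le _ _) _.
  rewrite mulrC ler_wpM2r ?cmod_ge0 // -mnormN opprB.
  apply: (avg_poisson_hpow pw); first by rewrite ltnS (leq_trans tm) ?leq_addl.
  move=> m; rewrite leq_subLR => hm; apply: hN0.
  by rewrite -(leq_add2r m0) (leq_trans (ltnW hm)) // addnC leq_add2l.
have -> : hcalc T f = P + (hcalc T f - P) by rewrite addrC subrK.
rewrite mulmxDl idotDl; apply: le_trans (cmodD _ _) _; apply: lerD.
  apply: (avg_poisson_bound pw) => // j; apply: hf.
  apply: (cmod_unity (ltn0Sn _) (_ : _ ^+ N = 1)).
  by rewrite -exprM mulnC exprM (prim_expr_order pw) expr1n.
apply: le_trans (cmod_idot_le _ _ _) _.
have := mnorm_ge0 (hcalc T f - P); have := vnorm_ge0 x; have := vnorm_ge0 y.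
move: (mnorm _) (vnorm x) (vnorm y) x1 y1 diff => a p q p1 q1 diff q0 p0 a0.
have : a * p <= a by nra.
have : a * p * q <= a * p by rewrite ler_piMr // mulr_ge0.
nra.
Qed.

End HarmonicCalculus.

(** * A convolution kernel of small mass *)

Lemma bernoulli (R : realFieldType) (h : R) n : 0 <= h -> 1 + n%:R * h <= (1 + h) ^+ n.
Proof.
move=> h0; elim: n => [|n IH]; first by rewrite expr0 mul0r addr0.
rewrite exprSr -natr1; apply: le_trans (_ : (1 + n%:R * h) * (1 + h) <= _).
  have : 0 <= n%:R * h * h by rewrite !mulr_ge0.
  nra.
by rewrite ler_wpM2r // addr_ge0.
Qed.

Lemma expr_vanish (R : realType) (t e : R) : 0 <= t -> t < 1 -> 0 < e ->
  exists N0, forall N, (N0 <= N)%N -> t ^+ N <= e.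
Proof.
move=> t0 t1 e0; have [->|tn0] := eqVneq t 0.
  by exists 1%N => -[//|N] _; rewrite expr0n ltW.
have tp : 0 < t by rewrite lt_neqAle eq_sym tn0.
pose h := t^-1 - 1; have h0 : 0 < h by rewrite subr_gt0 invf_gt1.
have x0 : 0 <= (h * e)^-1 by rewrite invr_ge0 mulr_ge0 // ltW.
exists (Num.bound (h * e)^-1) => N hN.
have NX : (h * e)^-1 <= N%:R.
  by rewrite (le_trans (ltW (archi_boundP x0))) // ler_nat.
have := bernoulli N (ltW h0); rewrite [1 + h]addrC subrK exprVn => hb.
have tN : 0 < t ^+ N by apply: exprn_gt0.
rewrite -[leRHS]invrK -[leLHS]invrK lef_pV2 ?posrE ?invr_gt0 //.
apply: le_trans hb; apply: le_trans (_ : N%:R * h <= _); last by rewrite lerDr.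
rewrite -ler_pdivrMr // -invfM; apply: le_trans NX.
by rewrite mulrC.
Qed.

Section AnnulusCalculus.
Context {R : realType}.
Local Notation C := R[i].
Local Notation laurent := (seq (C * int)).
Implicit Types (f g : laurent).

Lemma powers_vanish_lt1 d (T : 'M[C]_d.+1) : mnorm T < 1 -> powers_vanish T.
Proof.
move=> T1 e e0; have [N0 hN0] := expr_vanish (mnorm_ge0 T) T1 e0.
by exists N0 => N /hN0; apply: le_trans (mnormX _ _).
Qed.

Lemma idot_delta n (x : 'cV[C]_n) i : idot x (delta_mx i 0) = x i 0.
Proof.
rewrite idotE (bigD1 i) //= mxE !eqxx rmorph1 mulr1 big1 ?addr0 // => j ji.
by rewrite mxE (negPf ji) rmorph0 mulr0.
Qed.

Lemma vnorm_delta n (i : 'I_n) : vnorm (delta_mx i 0 : 'cV[C]_n) = 1.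
Proof.
apply/eqP; rewrite -sqrp_eq1 ?vnorm_ge0 // vnorm_sqr idot_delta mxE !eqxx.
by [].
Qed.

Definition mean f : C := \sum_(t <- f | t.2 == 0) t.1.

(** The mean of [f] over the circle is its harmonic calculus at [T = 0]. *)
Lemma cmod_mean f c : (forall z : C, cmod z = 1 -> cmod (lval z f) <= c) ->
  cmod (mean f) <= c.
Proof.
move=> hf; pose T : 'M[C]_1 := 0.
have T0 : mnorm T = 0 := mnorm0.
have := hcalc_contraction (T := T) _ _ hf; rewrite T0 ler01.
move=> /(_ isT (powers_vanish_lt1 _)); rewrite T0 ltr01 => /(_ isT) h.
pose e : 'cV[C]_1 := delta_mx 0 0.
have := cmod_idot_le (hcalc T f) e e; rewrite vnorm_delta !mulr1.
suff -> : idot (hcalc T f *m e) e = mean f by move=> h2; apply: le_trans h2 h.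
rewrite /hcalc mulmx_suml idot_suml /mean [RHS]big_mkcond.
apply: eq_bigr => t _; rewrite -scalemxAl idotZl.
case: t.2 => [[|n]|n] /=.
- by rewrite expr0 mul1mx idot_delta mxE !eqxx mulr1.
- by rewrite expr0n mul0mx idot0l mulr0.
- by rewrite ctr0 expr0n mul0mx idot0l mulr0.
Qed.

Section Weight.
Variable r : R.
Hypotheses (r0 : 0 < r) (r1 : r < 1).

(** One minus the minimum [(1 - r) / (1 + r)] of the Poisson kernel of
    parameter [r]. *)
Definition gap : R := 2 * r / (1 + r).

(** Fourier coefficients of the Poisson kernel minus its minimum. *)
Definition weight (n : int) : R := if n == 0 then gap else r ^+ `|n|.

Lemma gap_gt0 : 0 < gap.
Proof. by rewrite divr_gt0 ?mulr_gt0 ?addr_gt0. Qed.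

Lemma gap_lt1 : gap < 1.
Proof. by rewrite ltr_pdivrMr ?addr_gt0 // mul1r; have := r1; lra. Qed.

(* The rank one contraction [T = v w^H], with [w^H v = r] and unit vectors [v]
   and [w], satisfies [T ^+ n.+1 = r ^+ n *: T] and [<T e, e> = (1 + r) / 2], so
   that [gap * <T ^+ n e, e> = r ^+ n] for [n > 0], and [gap] for [n = 0]: the
   kernel is [gap] times the spectral measure of [T] at [e]. *)
Let a : R := Num.sqrt ((1 + r) / 2).
Let b : R := Num.sqrt ((1 - r) / 2).
Let v : 'cV[C]_2 := \col_i (if i == 0 then a else b)%:C.
Let w : 'cV[C]_2 := \col_i (if i == 0 then a else - b)%:C.
Let T : 'M[C]_2 := v *m w^H.
Let e : 'cV[C]_2 := delta_mx 0 0.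

Let aE : a ^+ 2 = (1 + r) / 2.
Proof. by rewrite sqr_sqrtr // divr_ge0 // addr_ge0 // ltW. Qed.

Let bE : b ^+ 2 = (1 - r) / 2.
Proof. by rewrite sqr_sqrtr // divr_ge0 // subr_ge0 ltW. Qed.

Let TE x : T *m x = idot x w *: v.
Proof.
have h : w^H *m x = (idot x w)%:M.
  apply/matrixP => i j; rewrite !ord1 idotE !mxE mulr1n.
  by apply: eq_bigr => k _; rewrite !mxE mulrC.
by rewrite -mulmxA h mul_mx_scalar.
Qed.

Let vnorm1 (x : 'cV[C]_2) : x 0 0 = a%:C -> x 1 0 = b%:C \/ x 1 0 = (- b)%:C ->
  vnorm x = 1.
Proof.
move=> h0 h1; apply/eqP; rewrite -sqrp_eq1 ?vnorm_ge0 // vnorm_sqr idotE.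
rewrite big_ord_recl big_ord1 (_ : lift ord0 ord0 = 1); last exact/val_inj.
rewrite h0 !mul_conj ReD /=.
have -> : cmod (x 1 0) ^+ 2 = b ^+ 2.
  by case: h1 => ->; rewrite cmodR ?normrN real_normK ?num_real.
by rewrite cmodR real_normK ?num_real // aE bE; apply/eqP; lra.
Qed.

Let v1 : vnorm v = 1. Proof. by apply: vnorm1; rewrite !mxE //=; left. Qed.
Let w1 : vnorm w = 1. Proof. by apply: vnorm1; rewrite !mxE //=; right. Qed.

Let vw : idot v w = r%:C.
Proof.
rewrite idotE big_ord_recl big_ord1 !mxE /= !conj_real -!rmorphM -rmorphD /=.
congr (_%:C); rewrite mulrN -!expr2 aE bE; lra.
Qed.

Let T1 : mnorm T <= 1.
Proof.
apply: mnorm_le => // x; rewrite TE vnormZ v1 mulr1 mul1r.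
by rewrite -[leRHS]mulr1 -w1 Cauchy_Schwarz.
Qed.

Let TX n : T ^+ n.+1 = (r ^+ n)%:C *: T.
Proof.
elim: n => [|n IH]; first by rewrite expr1 expr0 scale1r.
rewrite exprSr IH -scalerAl exprSr rmorphM -scalerA; congr (_ *: _).
by rewrite -[T * T]/(T *m T) {2}/T mulmxA TE vw -scalemxAl.
Qed.

Let T_vanish : powers_vanish T.
Proof.
move=> eps eps0; have [N0 hN0] := expr_vanish (ltW r0) r1 eps0.
exists N0.+1 => -[//|N] hN; rewrite TX; apply: le_trans (mnormZ_le _ _) _.
rewrite cmodR ger0_norm ?exprn_ge0 ?(ltW r0) //.
by apply: le_trans (hN0 N hN); rewrite ler_piMr ?exprn_ge0 ?(ltW r0).
Qed.

Let weightE n : gap%:C * idot (hpow T n *m e) e = (weight n)%:C.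
Proof.
have pos k : gap%:C * idot (T ^+ k *m e) e = (weight k)%:C.
  case: k => [|k].
    by rewrite expr0 mul1mx idot_delta mxE !eqxx mulr1.
  rewrite TX -scalemxAl idotZl TE idotZl idot_delta -idot_conj idot_delta !mxE /=.
  rewrite conj_real -!rmorphM /weight /= -expr2 aE /gap exprSr; congr (_%:C).
  by field; rewrite gt_eqF // addr_gt0.
case: n => [k|k]; first exact: pos.
have := congr1 Num.conj (pos k.+1).
rewrite rmorphM /= !conj_real idot_conj => h.
by rewrite /= -ctrX idot_adj ctrK h.
Qed.

(** The convolution of [f] with a positive kernel of mass [gap], here the
    Poisson kernel minus its minimum.  The kernel is represented by the
    contraction [T], so the bound is an instance of [hcalc_contraction]. *)
Lemma weight_bound f c : (forall z : C, cmod z = 1 -> cmod (lval z f) <= c) ->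
  cmod (\sum_(t <- f) t.1 * (weight t.2)%:C) <= gap * c.
Proof.
move=> hf; have h := hcalc_contraction T1 T_vanish hf.
have g0 : 0 <= gap := ltW gap_gt0.
have -> : \sum_(t <- f) t.1 * (weight t.2)%:C = gap%:C * idot (hcalc T f *m e) e.
  rewrite /hcalc mulmx_suml idot_suml mulr_sumr; apply: eq_bigr => t _.
  by rewrite -scalemxAl idotZl mulrCA weightE.
rewrite cmodM cmodR ger0_norm // ler_wpM2l // (le_trans _ h) //.
by have := cmod_idot_le (hcalc T f) e e; rewrite vnorm_delta !mulr1.
Qed.

End Weight.

End AnnulusCalculus.

(** * Reflection of a function in the annulus *)

Section Annulus.
Context {R : realType}.
Local Notation C := R[i].
Local Notation laurent := (seq (C * int)).
Variable s : R.
Hypothesis s1 : 1 < s.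

Implicit Types (f : laurent) (c : R).

Let s0 : 0 < s. Proof. exact: lt_trans s1. Qed.
Let rho : R := s ^- 2.
Let rho0 : 0 < rho. Proof. by rewrite invr_gt0 exprn_gt0. Qed.
Let rho1 : rho < 1. Proof. by rewrite invf_lt1 ?exprn_gt0 // exprn_egt1. Qed.

Lemma circle_neq0 (z : C) : cmod z = s \/ cmod z = s^-1 -> z != 0.
Proof.
rewrite -cmod_eq0 => -[->|->]; first by rewrite gt_eqF.
by rewrite invr_eq0 gt_eqF.
Qed.

Definition bounded_on_circles f c :=
  forall z : C, cmod z = s \/ cmod z = s^-1 -> cmod (lval z f) <= c.

(** The Cauchy transform of the conjugate of [f] over the boundary of the
    annulus, with its constant term multiplied by [gap]. *)
Definition reflection f : laurent :=
  [seq (t.1^* * (weight (s ^- 2) t.2)%:C, - t.2) | t <- f].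

(** At [z], the conjugate of the reflection is the convolution of [f] with the
    kernel of [weight_bound] at [u = 1 / z^*]; inversion exchanges the circles. *)
Lemma bounded_reflection f c : bounded_on_circles f c ->
  bounded_on_circles (reflection f) (gap (s ^- 2) * c).
Proof.
move=> hf z hz; pose u := (z^*)^-1.
have cu : cmod u = s \/ cmod u = s^-1.
  by rewrite /u cmodV cmod_conj; case: hz => ->; rewrite ?invrK; [right|left].
have hu (y : C) : cmod y = 1 -> cmod (lval y (ldilate u f)) <= c.
  by move=> y1; rewrite lval_dilate; apply: hf; rewrite cmodM y1 mulr1.
have := weight_bound rho0 rho1 hu; congr (_ <= _).
rewrite -cmod_conj /lval /ldilate /reflection !big_map rmorph_sum; congr cmod.
apply: eq_bigr => t _ /=; rewrite 2!rmorphM /= conj_exprz. 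
rewrite conj_real /u fmorphV /= conjCK exprz_inv /rho; ring.
Qed.

Section Operator.
Variables (d : nat) (A : 'M[C]_d.+1).
Hypotheses (As : mnorm A < s) (Ais : mnorm A^-1 < s).

Let Ts : C := (s^-1)%:C.

Let mnorm_scaled (B : 'M[C]_d.+1) : mnorm B < s -> mnorm (Ts *: B) < 1.
Proof.
move=> h; apply: le_lt_trans (mnormZ_le _ _) _.
by rewrite cmodR gtr0_norm ?invr_gt0 // ltr_pdivrMl // mulr1.
Qed.

Let hpow_annulus (n : int) :
  s%:C ^ n *: hpow (Ts *: A) n + Ts ^ n *: hpow (Ts *: A^-1) (- n) =
  A ^ n + (weight (s ^- 2) n)%:C *: (A ^ (- n))^H
  + ((1 - gap (s ^- 2)) * (n == 0)%:R)%:C *: 1.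
Proof.
have pos (B : 'M[C]_d.+1) k : s%:C ^+ k *: (Ts *: B) ^+ k = B ^+ k.
  by rewrite exprZn scalerA -exprMn -rmorphM /= divff ?gt_eqF // expr1n scale1r.
have neg (B : 'M[C]_d.+1) k :
    Ts ^+ k *: ((Ts *: B) ^+ k)^H = (rho ^+ k)%:C *: (B ^+ k)^H.
  rewrite exprZn ctrZ scalerA rmorphXn /= conj_real -exprMn -rmorphM rmorphXn /=.
  by rewrite /rho expr2 invfM.
have TsV : Ts^-1 = s%:C by rewrite /Ts fmorphV invrK.
rewrite hpowN; case: n => [[|k]|k].
- rewrite !expr0z /= !expr0 !scale1r mulr1 /weight eqxx -idmxE ctr1.
  by rewrite -addrA -scalerDl rmorphB addrC [_%:C + _]addrC subrK scale1r.
- rewrite /= -!exprnP pos neg mulr0 scale0r addr0 /weight /=.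
  by rewrite -exprz_inv -exprnP.
- have -> : weight (s ^- 2) (Negz k) = rho ^+ k.+1 by [].
  rewrite /= mulr0 scale0r addr0 NegzE -!exprz_inv TsV -fmorphV /= -/Ts.
  by rewrite -!exprnP -!ctrX ctrK neg pos addrC invrK.
Qed.

(** For [n > 0] the outer calculus contributes [A ^ n] and the inner one
    [s^-2n (A ^ - n)^H], for [n < 0] the two roles are exchanged, and for [n = 0]
    both contribute [1], one of which is split as [gap + (1 - gap)]. *)
Lemma hcalc_annulus f :
  hcalc ((s^-1)%:C *: A) (ldilate s%:C f)
  + hcalc ((s^-1)%:C *: A^-1) (lflip (ldilate (s^-1)%:C f)) =
  lev A f + (lev A (reflection f))^H + ((1 - gap (s ^- 2))%:C * mean f) *: 1.
Proof.
rewrite /hcalc /lflip /lev /mean /reflection !big_map ctr_sum /=.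
rewrite [X in _ + _ + (_ * X) *: _]big_mkcond mulr_sumr scaler_suml -!big_split /=.
apply: eq_bigr => -[a n] _ /=.
have /= := congr1 (fun B => a *: B) (hpow_annulus n).
rewrite [LHS]scalerDr 2!scalerA => ->; rewrite !scalerDr !scalerA.
have wE : (a^* * (weight (s ^- 2) n)%:C)^* = a * (weight (s ^- 2) n)%:C.
  by rewrite rmorphM /= conjCK conj_real.
rewrite ctrZ wE rmorphM /= mulrCA.
by case: (n == 0); rewrite ?mulr1 ?mulr0.
Qed.

Lemma cmod_mean_circles f c : bounded_on_circles f c -> cmod (mean f) <= c.
Proof.
move=> hf; have -> : mean f = mean (ldilate s%:C f).
  rewrite /mean big_map; apply: eq_bigr => t /eqP ->.
  by rewrite expr0z mulr1.
apply: cmod_mean => z z1; rewrite lval_dilate; apply: hf.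
by left; rewrite cmodM z1 mulr1 cmodR gtr0_norm.
Qed.

Lemma mnorm_lev_reflection f c : bounded_on_circles f c ->
  mnorm (lev A f + (lev A (reflection f))^H
         + ((1 - gap (s ^- 2))%:C * mean f) *: 1) <= 2 * c.
Proof.
move=> hf; rewrite -hcalc_annulus; apply: le_trans (mnormD _ _) _.
rewrite mulr_natl mulr2n; apply: lerD; apply: hcalc_contraction;
  rewrite ?(ltW (mnorm_scaled _)) //; try exact/powers_vanish_lt1/mnorm_scaled.
- move=> z z1; rewrite lval_dilate; apply: hf.
  by left; rewrite cmodM z1 mulr1 cmodR gtr0_norm.
- move=> z z1; rewrite lval_flip lval_dilate; apply: hf.
  by right; rewrite cmodM cmodV z1 invr1 mulr1 cmodR gtr0_norm ?invr_gt0.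
Qed.

Local Notation kap := (gap (s ^- 2)).

Let kap_ge : rho <= kap.
Proof. by rewrite /gap ler_pdivlMr; have := rho0; have := rho1; rewrite -/rho; nra. Qed.

Let kap0 : 0 < kap. Proof. exact: gap_gt0. Qed.

Let kap1 : kap < 1. Proof. exact: gap_lt1. Qed.

Let weight_ge0 n : 0 <= weight (s ^- 2) n.
Proof.
rewrite /weight; case: ifP => _; first exact: ltW.
by rewrite exprn_ge0 // ltW.
Qed.

Let weight_le n : weight (s ^- 2) n <= kap.
Proof.
rewrite /weight; case: eqP => // /eqP n0; apply: le_trans kap_ge.
have : (0 < `|n|)%N by rewrite absz_gt0.
case: `|n|%N => // k _; rewrite exprS ler_piMr ?(ltW rho0) //.
by rewrite exprn_ile1 // ltW.
Qed.

(** A seminorm dominating [mnorm (lev A f)], symmetric in [n] and [- n] because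
    the reflection changes the sign of the exponents. *)
Let lsize f := \sum_(t <- f) cmod t.1 * (mnorm (A ^ t.2) + mnorm (A ^ (- t.2))).

Let lev_le_lsize f : mnorm (lev A f) <= lsize f.
Proof.
apply: le_trans (mnorm_sum _ _) _; apply: ler_sum => t _.
apply: le_trans (mnormZ_le _ _) _; rewrite ler_wpM2l ?cmod_ge0 //.
by rewrite lerDl mnorm_ge0.
Qed.

Let lsize_reflection f : lsize (reflection f) <= kap * lsize f.
Proof.
rewrite /lsize /reflection big_map mulr_sumr; apply: ler_sum => t _ /=.
rewrite cmodM cmod_conj cmodR ger0_norm // opprK [mnorm _ + _]addrC mulrA.
rewrite ler_wpM2r ?addr_ge0 ?mnorm_ge0 // mulrC.
by rewrite ler_wpM2r ?cmod_ge0.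
Qed.

(** Each reflection shrinks both the bound on the circles and the coefficients
    by the factor [kap < 1], so that
    [mnorm (lev A f) <= 3 c + mnorm (lev A (reflection f))] can be iterated: a
    geometric series remains, and the last term tends to [0]. *)
Lemma lev_bounded f : bounded_on_circles f 1 ->
  mnorm (lev A f) <= 3 / (1 - kap).
Proof.
have k1 : 0 < 1 - kap by rewrite subr_gt0.
have step k g c L : 0 <= c -> bounded_on_circles g c -> lsize g <= L ->
    mnorm (lev A g) <= 3 * c / (1 - kap) + kap ^+ k * L.
  elim: k g c L => [|k IH] g c L c0 hg gL.
    rewrite expr0 mul1r; apply: le_trans (lev_le_lsize g) _.
    by rewrite (le_trans gL) // lerDr divr_ge0 ?mulr_ge0 // ltW.
  have := IH (reflection g) (kap * c) (kap * L).
  move=> /(_ (mulr_ge0 (ltW kap0) c0) (bounded_reflection hg)) h.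
  have {}h := h (le_trans (lsize_reflection g) (ler_wpM2l (ltW kap0) gL)).
  have := mnorm_lev_reflection hg; set S := (X in mnorm X) => hS.
  have -> : lev A g = S - (lev A (reflection g))^H - ((1 - kap)%:C * mean g) *: 1.
    by rewrite /S addrAC addrK addrK.
  apply: le_trans (mnormB _ _) _.
  apply: le_trans (lerD (mnormB _ _) (lexx _)) _; rewrite mnorm_adj.
  have h1 : mnorm (((1 - kap)%:C * mean g) *: (1 : 'M[C]_d.+1)) <= c.
    apply: le_trans (mnormZ_le _ _) _; rewrite cmodM cmodR gtr0_norm //.
    have := cmod_mean_circles hg; have := cmod_ge0 (mean g).
    have : mnorm (1 : 'M[C]_d.+1) <= 1 by rewrite -idmxE mnorm1_le.
    have := mnorm_ge0 (1 : 'M[C]_d.+1) => a0 a1 b0 b1.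
    have : (1 - kap) * cmod (mean g) <= c by have := kap0; nra.
    have : 0 <= (1 - kap) * cmod (mean g) by rewrite mulr_ge0 // ltW.
    nra.
  have E : 3 * c / (1 - kap) = 3 * c + 3 * (kap * c) / (1 - kap).
    by field; rewrite gt_eqF.
  rewrite E [kap ^+ k.+1]exprSr -mulrA; lra.
move=> hf; apply/ler_addgt0Pr => e e0.
have L0 : 0 <= lsize f := le_trans (mnorm_ge0 _) (lev_le_lsize f).
have e1 : 0 < e / (lsize f + 1) by rewrite divr_gt0 // ltr_wpDl.
have [N hN] := expr_vanish (ltW kap0) kap1 e1.
have := step N f 1 (lsize f) ler01 hf (lexx _); rewrite mulr1 => h.
apply: le_trans h _; rewrite lerD2l.
apply: le_trans (ler_wpM2r L0 (hN N (leqnn _))) _.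
by rewrite mulrAC ler_pdivrMr ?ltr_wpDl // ler_wpM2l ?(ltW e0) // lerDl.
Qed.

End Operator.
End Annulus.

(** * Extremal functions *)

Lemma cmod_half_plane (R : realType) (c w : R[i]) : cmod c <= 1 -> cmod w <= 1 ->
  cmod (w - c) <= cmod (1 - c^* * w).
Proof.
move=> c1 w1; rewrite -(ler_pXn2r (n := 2)) ?nnegrE ?cmod_ge0 //.
have -> : cmod (1 - c^* * w) ^+ 2 =
    cmod (w - c) ^+ 2 + (1 - cmod c ^+ 2) * (1 - cmod w ^+ 2).
  apply: (@complexI R); rewrite rmorphD /= -!mul_conj.
  have -> : ((1 - cmod c ^+ 2) * (1 - cmod w ^+ 2))%:C =
      (1 - c * c^*) * (1 - w * w^*) by rewrite !mul_conj rmorphM !rmorphB.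
  by rewrite !rmorphB rmorphM /= conjCK rmorph1; ring.
by rewrite lerDl mulr_ge0 // subr_ge0 expr_le1 ?cmod_ge0.
Qed.

(** The polynomial in [w] is the second order truncation, as [c] tends to [0],
    of the disk automorphism sending [c] to [0].  It leaves the disk by a
    quantity of second order only, and maps Laurent polynomials to Laurent
    polynomials, which the automorphism does not. *)
Lemma truncated_mobius (R : realType) (c w : R[i]) : cmod c <= 1 -> cmod w <= 1 ->
  cmod (w - c + c^* * w ^+ 2) <= 1 + 2 * cmod c ^+ 2.
Proof.
move=> c1 w1.
have -> : w - c + c^* * w ^+ 2 = (w - c) * (1 + c^* * w) + (c * c^*) * w by ring.
apply: le_trans (cmodD _ _) _; rewrite !cmodM cmod_conj.
have h : cmod (w - c) * cmod (1 + c^* * w) <= 1 + cmod c ^+ 2.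
  apply: le_trans (ler_wpM2r (cmod_ge0 _) (cmod_half_plane c1 w1)) _.
  rewrite -cmodM (_ : _ * _ = 1 - (c^* * w) ^+ 2); last by ring.
  apply: le_trans (cmodB _ _) _; rewrite cmod1 cmodX cmodM cmod_conj exprMn.
  by rewrite lerD2l ler_piMr ?exprn_ge0 ?cmod_ge0 // expr_le1 ?cmod_ge0.
have := cmod_ge0 c; have := cmod_ge0 w; nra.
Qed.

Section Extremal.
Context {R : realType}.
Local Notation C := R[i].
Local Notation laurent := (seq (C * int)).
Variable s : R.
Hypothesis s1 : 1 < s.
Variables (d : nat) (A : 'M[C]_d.+1).
Hypotheses (uA : A \is a GRing.unit) (As : mnorm A < s) (Ais : mnorm A^-1 < s).
Implicit Types (f g : laurent) (c : R).

Local Notation bounded := (bounded_on_circles s).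
Local Notation kap := (gap (s ^- 2)).

Let s0 : 0 < s. Proof. exact: lt_trans s1. Qed.
Let kap0 : 0 < kap. Proof. by apply: gap_gt0; rewrite invr_gt0 exprn_gt0. Qed.
Let kap1 : kap < 1.
Proof.
by apply: gap_lt1; rewrite ?invf_lt1 ?invr_gt0 ?exprn_gt0 // exprn_egt1.
Qed.

Lemma bounded_mul f g c1 c2 : bounded f c1 -> bounded g c2 ->
  bounded (lmul f g) (c1 * c2).
Proof.
move=> hf hg z hz; rewrite lval_mul ?(circle_neq0 s1) // cmodM.
by apply: ler_pM; rewrite ?cmod_ge0 ?hf ?hg.
Qed.

Definition Klaurent : R := sup [set mnorm (lev A f) | f in [set f | bounded f 1]]%classic.

Local Notation K := Klaurent.

Let bounded1 : bounded (lconst 1) 1.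
Proof. by move=> z hz; rewrite lval_const cmod1. Qed.

Let K_has_sup :
  has_sup [set mnorm (lev A f) | f in [set f | bounded f 1]]%classic.
Proof.
split; first by exists (mnorm (lev A (lconst 1))), (lconst 1).
exists (3 / (1 - kap)) => _ [f /= hf <-]; exact: lev_bounded.
Qed.

Lemma mnorm_lev_le f c : 0 < c -> bounded f c -> mnorm (lev A f) <= K * c.
Proof.
move=> c0 hf; pose g := lscale (c^-1)%:C f.
have hg : bounded g 1.
  move=> z hz; rewrite lval_scale cmodM cmodR.
  by rewrite gtr0_norm ?invr_gt0 // ler_pdivrMl // mulr1 hf.
have -> : lev A f = c%:C *: lev A g.
  by rewrite lev_scale scalerA -rmorphM /= divff ?gt_eqF // scale1r.
apply: le_trans (mnormZ_le _ _) _; rewrite cmodR gtr0_norm // mulrC.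
rewrite ler_pM2r //; apply: (sup_upper_bound K_has_sup).
by exists g.
Qed.

Lemma K_ge0 : 0 <= K.
Proof. by have := mnorm_lev_le ltr01 bounded1; rewrite mulr1; apply/le_trans/mnorm_ge0. Qed.

Section NearExtremal.
Variables (f : laurent) (x : 'cV[C]_d.+1).
Hypotheses (hf : bounded f 1) (x1 : vnorm x <= 1).
Let M := lev A f.
Let sg := vnorm (M *m x).
Hypothesis sg2 : 2 < sg.
Let y := (sg^-1)%:C *: (M *m x).
Let sp := idot x y.

Let sg0 : 0 < sg. Proof. exact: lt_trans sg2. Qed.
Let K0 : 0 < K.
Proof.
apply: lt_le_trans sg0 _; apply: le_trans (le_mnorm M x) _.
have := mnorm_lev_le ltr01 hf; rewrite mulr1 => h.
by apply: le_trans h; rewrite ler_piMr ?mnorm_ge0.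
Qed.
Let MK : mnorm M <= K.
Proof. by have := mnorm_lev_le ltr01 hf; rewrite mulr1. Qed.
Let Mx : M *m x = sg%:C *: y.
Proof. by rewrite /y scalerA -rmorphM /= divff ?gt_eqF // scale1r. Qed.

Let y1 : vnorm y = 1.
Proof. by rewrite /y vnormZ cmodR gtr0_norm ?invr_gt0 // -/sg mulVf ?gt_eqF. Qed.

(** Zero for an exact extremal pair. *)
Let err := M^H *m y - sg%:C *: x.

Let Mxy : idot (M *m x) y = sg%:C.
Proof. by rewrite Mx idotZl vnormE y1 expr1n mulr1. Qed.

Lemma err_small : vnorm err ^+ 2 <= K ^+ 2 - sg ^+ 2.
Proof.
rewrite /err vnorm_sqrD vnormN idotNr idotZr conj_real ReN ReZ.
have -> : Re (idot (M^H *m y) x) = sg.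
  by rewrite -idot_conj -idot_adj Mxy.
have h : vnorm (M^H *m y) ^+ 2 <= K ^+ 2.
  rewrite ler_pXn2r ?nnegrE ?vnorm_ge0 ?(ltW K0) //.
  by apply: le_trans (le_mnorm _ _) _; rewrite mnorm_adj y1 mulr1.
have : vnorm (sg%:C *: x) ^+ 2 <= sg ^+ 2.
  rewrite ler_pXn2r ?nnegrE ?vnorm_ge0 ?(ltW sg0) // vnormZ cmodR gtr0_norm //.
  by rewrite ler_piMr // ltW.
nra.
Qed.

Let sp1 : cmod sp <= 1.
Proof.
by apply: le_trans (Cauchy_Schwarz _ _) _; rewrite y1 mulr1.
Qed.

(** The image of [f] under a small disk automorphism taking [c = t sp^*] to [0]
    is again almost bounded by [1], while its value at the pair [x, y] exceeds
    [sg] by about [(sg^2 - 1) t |sp|^2]; this cannot exceed [K]. *)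
Lemma near_orthogonal (t : R) : 0 < t -> t <= 1 ->
  (sg ^+ 2 - 1) * t * cmod sp ^+ 2 <=
  K - sg + 2 * K * t ^+ 2 + sg * t * vnorm err.
Proof.
move=> t0 t1; pose c := t%:C * sp^*.
have cc : cmod c = t * cmod sp by rewrite cmodM cmod_conj cmodR gtr0_norm.
have c1 : cmod c <= 1 by rewrite cc mulr_ile1 ?cmod_ge0 // ltW.
pose g := f ++ lconst (- c) ++ lscale c^* (lmul f f).
have hg : bounded g (1 + 2 * cmod c ^+ 2).
  move=> z hz; rewrite !lval_cat lval_const lval_scale lval_mul ?(circle_neq0 s1) //.
  by rewrite addrA -expr2; apply: truncated_mobius => //; apply: hf.
have g0 : 0 < 1 + 2 * cmod c ^+ 2 by have := sqr_ge0 (cmod c); lra.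
have := mnorm_lev_le g0 hg => hK.
have hN : Re (idot (lev A g *m x) y) <= K * (1 + 2 * cmod c ^+ 2).
  apply: le_trans (Re_le_cmod _) _; apply: le_trans (cmod_idot_le _ _ _) _.
  by rewrite y1 mulr1; apply: le_trans hK; rewrite ler_piMr ?mnorm_ge0.
have [p pE] : exists p, idot y err = p by exists (idot y err).
have M2 : idot (M * M *m x) y = (sg ^+ 2)%:C * sp^* + sg%:C * p.
  rewrite -[M * M]/(M *m M) -mulmxA Mx -scalemxAr idotZl idot_adj.
  have -> : M^H *m y = sg%:C *: x + err by rewrite addrC subrK.
  rewrite idotDr idotZr conj_real -/sp -[idot y x]idot_conj -/sp rmorphXn pE.
  by rewrite expr2 mulrDr !mulrA.
have E : idot (lev A g *m x) y =
    sg%:C - t%:C * (cmod sp ^+ 2)%:C + t%:C * ((sg ^+ 2)%:C * (cmod sp ^+ 2)%:C)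
    + sg%:C * (t%:C * (sp * p)).
  rewrite !lev_cat lev_const lev_scale lev_mul // -/M !mulmxDl !idotDl Mxy.
  rewrite -!scalemxAl !idotZl -idmxE mul1mx -/sp M2.
  rewrite -!mul_conj /c rmorphM /= conjCK conj_real; ring.
move: hN; rewrite {}E !ReD ReN !ReZ /= cc exprMn.
have : - vnorm err <= Re (sp * p).
  rewrite -pE lerNl -ReN; apply: le_trans (Re_le_cmod _) _; rewrite cmodN cmodM.
  have h := Cauchy_Schwarz y err; rewrite y1 mul1r in h.
  by rewrite -[leRHS]mul1r ler_pM ?cmod_ge0.
have := sqr_ge0 t; have := K0; have := sg0; move: (Re (sp * _)) (vnorm err) => b q.
have : cmod sp ^+ 2 <= 1 by rewrite expr_le1 ?cmod_ge0.
have := sqr_ge0 (cmod sp); move: (cmod sp ^+ 2) => S S0 S1 g00 k0 tt hq hN.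
have h1 : 0 <= sg * t * (b + q) 
  by rewrite mulr_ge0 ?mulr_ge0 ?(ltW sg0) ?(ltW t0) //; move: hq; lra.
have h2 : K * (t ^+ 2 * S) <= K * t ^+ 2 by rewrite ler_wpM2l ?(ltW k0) // ler_piMr.
nra.
Qed.

(** The term [<x, g(A) y>], multiplied by [sg^2], becomes up to [err] the value
    at [x, y] of [(f g f)(A)], whose norm is at most [K * kap]. *)
Lemma near_extremal_bound :
  sg ^+ 2 * (sg - 2 - cmod sp) <= K * kap * (1 + vnorm err).
Proof.
pose G := lev A (reflection s f).
have hc := bounded_reflection s1 hf; rewrite mulr1 in hc.
have hM : mnorm (G *m M) <= K * kap.
  rewrite -[G *m M]/(G * M) -lev_mul //; apply: mnorm_lev_le => //.
  by have := bounded_mul hc hf; rewrite mulr1.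
have hMM : mnorm (M *m (G *m M)) <= K * kap.
  rewrite -[G *m M]/(G * M) -[M *m _]/(M * _) -!lev_mul //.
  apply: mnorm_lev_le => //.
  by have := bounded_mul hf (bounded_mul hc hf); rewrite mulr1 mul1r.
have hS := mnorm_lev_reflection s1 As Ais hf; rewrite mulr1 -/M -/G in hS.
set S := (X in mnorm X) in hS.
have E : (sg ^+ 2)%:C * (idot (G^H *m x) y)^* =
    idot ((M *m (G *m M)) *m x) y - idot ((G *m M) *m x) err.
  have sx : sg%:C *: x = M^H *m y - err by rewrite /err opprB addrC subrK.
  have e1 : idot ((M *m (G *m M)) *m x) y = idot ((G *m M) *m x) (M^H *m y).
    by rewrite -(mulmxA M) (idot_adj M).
  have e2 : (idot (G^H *m x) y)^* = idot (G *m y) x.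
    by rewrite (idot_adj (G^H)) ctrK idot_conj.
  have e3 : idot ((G *m M) *m x) x = sg%:C * idot (G *m y) x.
    by rewrite -(mulmxA G) Mx -scalemxAr idotZl.
  by rewrite e1 -idotBr -sx idotZr conj_real e2 e3 mulrA -rmorphM -expr2.
have h1 : sg ^+ 2 * cmod (idot (G^H *m x) y) <= K * kap * (1 + vnorm err).
  have -> : sg ^+ 2 * cmod (idot (G^H *m x) y) =
      cmod ((sg ^+ 2)%:C * (idot (G^H *m x) y)^*).
    by rewrite cmodM cmodR cmod_conj ger0_norm ?sqr_ge0.
  rewrite E mulrDr mulr1; apply: le_trans (cmodB _ _) _; apply: lerD.
    apply: le_trans (cmod_idot_le _ _ _) _; rewrite y1 mulr1.
    by apply: le_trans hMM; rewrite ler_piMr ?mnorm_ge0.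
  apply: le_trans (cmod_idot_le _ _ _) _; rewrite ler_wpM2r ?vnorm_ge0 //.
  by apply: le_trans hM; rewrite ler_piMr ?mnorm_ge0.
have h2 : sg <= 2 + cmod (idot (G^H *m x) y) + cmod sp.
  have -> : sg = cmod (idot (M *m x) y) by rewrite Mxy cmodR gtr0_norm.
  have -> : M = S - G^H - ((1 - kap)%:C * mean f) *: 1.
    by rewrite /S addrAC addrK addrK.
  rewrite !mulmxBl !idotBl -scalemxAl idotZl -idmxE mul1mx -/sp.
  apply: le_trans (cmodB _ _) _; apply: lerD.
    apply: le_trans (cmodB _ _) _; rewrite lerD2r.
    apply: le_trans (cmod_idot_le _ _ _) _; rewrite y1 mulr1.
    by apply: le_trans hS; rewrite ler_piMr ?mnorm_ge0.
  rewrite !cmodM cmodR gtr0_norm ?subr_gt0 //.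
  rewrite ler_piMl ?cmod_ge0 // mulr_ile1 ?cmod_ge0 ?subr_ge0 ?(ltW kap1) //.
    by rewrite lerBlDr lerDl ltW.
  exact: (cmod_mean_circles s1 hf).
apply: le_trans h1; rewrite ler_wpM2l ?sqr_ge0 //; lra.
Qed.
End NearExtremal.
(** All errors of the two previous estimates are made smaller than [eta]. *)
Let near_extremal_ineq (eta : R) : 0 < eta -> eta <= 1 -> 2 * eta < K - 2 ->
  (K - eta) ^+ 2 * (K - 2 - 2 * eta) <= K * kap * (1 + eta).
Proof.
move=> e0 e1 eK; have K2 : 2 < K by lra.
have K0 : 0 < K by lra.
(* With these values the three terms bounding [3 t |sp|^2] in
   [near_orthogonal] are each at most [t eta^2]. *)
pose t := eta ^+ 2 / (2 * K); pose dl := eta ^+ 2 / K.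
have ee : eta ^+ 2 <= eta by rewrite expr2 ler_piMr // ltW.
have ee0 : 0 < eta ^+ 2 by rewrite exprn_gt0.
have t0 : 0 < t by rewrite divr_gt0 // mulr_gt0.
have tE : t * (2 * K) = eta ^+ 2 by rewrite divfK // gt_eqF // mulr_gt0.
have t1 : t <= 1 by rewrite ler_pdivrMr ?mulr_gt0 //; lra.
have dl0 : 0 < dl by rewrite divr_gt0.
have dlE : dl * K = eta ^+ 2 by rewrite divfK // gt_eqF.
have dle : dl <= eta by rewrite ler_pdivrMr //; nra.
pose ep := Num.min eta (Num.min (t * eta ^+ 2) (dl ^+ 2 / (2 * K))).
have ep0 : 0 < ep.
  rewrite !lt_min e0 (mulr_gt0 t0 ee0) /=.
  by apply: divr_gt0; [exact: exprn_gt0|exact: mulr_gt0].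
have [ep1 ep2 ep3] : [/\ ep <= eta, ep <= t * eta ^+ 2 & ep * (2 * K) <= dl ^+ 2].
  split; rewrite -?[_ * (2 * _) <= _]ler_pdivlMr ?mulr_gt0 //;
    by rewrite !ge_min lexx ?orbT.
clearbody ep.
have [_ [f /= hf <-] hfK] := sup_adherent ep0 K_has_sup.
have [x x1 hx] : exists2 x, vnorm x <= 1 & K - ep < vnorm (lev A f *m x).
  exact: mnorm_near hfK.
have sg2 : 2 < vnorm (lev A f *m x) by apply: le_lt_trans hx; lra.
have hK : vnorm (lev A f *m x) <= K.
  apply: le_trans (le_mnorm _ _) _; have := mnorm_lev_le ltr01 hf; rewrite mulr1.
  by apply: le_trans; rewrite ler_piMr ?mnorm_ge0.
have herr := err_small hf x1 sg2.
have horth := near_orthogonal hf x1 sg2 t0 t1.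
have hbnd := near_extremal_bound hf x1 sg2.
move: (vnorm (_ - _)) (vnorm_ge0 ((lev A f)^H *m ((vnorm (lev A f *m x))^-1%:C
  *: (lev A f *m x)) - (vnorm (lev A f *m x))%:C *: x)) herr horth hbnd => er er0.
move: (cmod _) (cmod_ge0 (idot x ((vnorm (lev A f *m x))^-1%:C *: (lev A f *m x)))).
move: (vnorm (lev A f *m x)) hx sg2 hK.
move=> sg hx sg2 hK S S0 herr horth hbnd.
have erdl : er <= dl.
  rewrite -(ler_pXn2r (n := 2)) ?nnegrE ?(ltW dl0) //.
  by apply: le_trans herr _; apply: le_trans ep3; nra.
have Seta : S <= eta.
  rewrite -(ler_pXn2r (n := 2)) ?nnegrE ?(ltW e0) // -(ler_pM2l t0).
  have a1 : 3 * (t * S ^+ 2) <= (sg ^+ 2 - 1) * t * S ^+ 2.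
    have sg4 : 3 <= sg ^+ 2 - 1 by have := sqr_ge0 (sg - 2); rewrite sqrrB; lra.
    by rewrite -[leRHS]mulrA; apply: ler_wpM2r sg4; rewrite mulr_ge0 ?sqr_ge0 ?(ltW t0).
  have a2 : 2 * K * t ^+ 2 = t * eta ^+ 2 by rewrite -tE; ring.
  have a3 : sg * t * er <= t * eta ^+ 2.
    rewrite -dlE mulrAC mulrC ler_wpM2l ?(ltW t0) // mulrC.
    by apply: ler_pM => //; lra.
  by lra.
apply: le_trans (_ : sg ^+ 2 * (sg - 2 - S) <= _); last first.
  apply: le_trans hbnd _.
  apply: ler_wpM2l; first by rewrite mulr_ge0 ?(ltW K0) ?(ltW kap0).
  by rewrite lerD2l (le_trans erdl dle).
apply: ler_pM; rewrite ?sqr_ge0 //; try lra.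
have h1 : K - eta <= sg by lra.
have h2 : 0 <= K - eta by lra.
by apply: lerXn2r => //; rewrite nnegrE // (le_trans h2).
Qed.

(** The limit of the previous inequality as [eta] tends to [0]. *)
Lemma Klaurent_quadratic : K * (K - 2) <= kap.
Proof.
have K0 := K_ge0; have [K2|K2] := lerP K 2.
  by have := kap0; nra.
rewrite leNgt; apply/negP => kK.
have Kp : 0 < K by lra.
have K2p : 0 < K ^+ 2 by rewrite exprn_gt0.
pose D := K * (K * (K - 2) - kap).
have D0 : 0 < D by rewrite mulr_gt0 // subr_gt0.
pose eta := Num.min 1 (Num.min ((K - 2) / 4) (D / (6 * K ^+ 2))).
have eta0 : 0 < eta.
  by rewrite !lt_min ltr01 !divr_gt0 ?mulr_gt0 ?subr_gt0.
have [h1 h2 h3] : [/\ eta <= 1, eta <= (K - 2) / 4 & eta * (6 * K ^+ 2) <= D].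
  split; rewrite -?[_ * (6 * _) <= _]ler_pdivlMr ?mulr_gt0 //;
    by rewrite !ge_min lexx ?orbT.
clearbody eta.
have := near_extremal_ineq eta0 h1 (ltac:(lra)).
have b1 : (K ^+ 2 - 2 * K * eta) * (K - 2 - 2 * eta) <=
          (K - eta) ^+ 2 * (K - 2 - 2 * eta).
  rewrite ler_wpM2r; [by []|lra|]; have := sqr_ge0 eta.
  by rewrite sqrrB; lra.
have b2 : K * kap * eta <= K ^+ 2 * eta.
  by rewrite ler_wpM2r ?(ltW eta0) // expr2 ler_wpM2l //; have := kap1; lra.
have b3 : 0 <= K * eta * eta by rewrite !mulr_ge0 // ltW.
have b4 : 0 < K ^+ 2 * eta by rewrite mulr_gt0.
have b5 : 0 <= K * eta by rewrite mulr_ge0 // ltW.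
move: h3; rewrite /D => h3 h4.
have : (K ^+ 2 - 2 * K * eta) * (K - 2 - 2 * eta) =
  K ^+ 2 * (K - 2) - 4 * (K ^+ 2 * eta) + 4 * (K * eta) + 4 * (K * eta * eta).
  by ring.
nra.
Qed.

End Extremal.

(** * From Laurent polynomials to rational functions *)

Section RationalFunctions.
Context {R : realType}.
Local Notation C := R[i].
Local Notation laurent := (seq (C * int)).
Variables r s : R.
Hypotheses (s1 : 1 < s) (sr : s < r).

Let s0 : 0 < s. Proof. exact: lt_trans s1. Qed.
Let r0 : 0 < r. Proof. exact: lt_trans sr. Qed.

Lemma annulusE (z : C) : annulus r z <-> r^-1 < cmod z < r.
Proof. by rewrite /annulus /= -cmodE !ltcR. Qed.

Let circle_annulus (z : C) : cmod z = s \/ cmod z = s^-1 -> annulus r z.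
Proof.
rewrite annulusE => -[->|->]; apply/andP; split => //.
- by apply: lt_trans s1; rewrite invf_lt1 // (lt_trans s1).
- by rewrite ltf_pV2.
- by apply: lt_trans sr; apply: lt_trans s1; rewrite invf_lt1.
Qed.

(** Approximate inversion of [q] by Laurent polynomials, uniformly on the
    circles; by [mnorm_lev_le] it holds at [A] as well. *)
Definition invertible_on_circles (q : {poly C}) := forall eta : R, 0 < eta ->
  exists l : laurent, forall z : C, cmod z = s \/ cmod z = s^-1 ->
    cmod (q.[z] * lval z l - 1) <= eta.

Lemma invertible_const (c : C) : c != 0 -> invertible_on_circles c%:P.
Proof.
move=> c0 eta eta0; exists (lconst c^-1) => z _.
by rewrite hornerC lval_const divff // subrr cmod0 ltW.
Qed.

Lemma invertible_mul q1 q2 : invertible_on_circles q1 -> invertible_on_circles q2 ->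
  invertible_on_circles (q1 * q2).
Proof.
move=> h1 h2 eta eta0; pose e := Num.min 1 (eta / 3).
have e0 : 0 < e by rewrite lt_min ltr01 divr_gt0.
have [e1 e3] : e <= 1 /\ 3 * e <= eta.
  by rewrite mulrC -ler_pdivlMr // !ge_min !lexx orbT.
have [[l1 hl1] [l2 hl2]] := (h1 e e0, h2 e e0).
exists (lmul l1 l2) => z hz; have z0 := circle_neq0 s1 hz.
have := hl1 z hz; have := hl2 z hz; rewrite hornerM lval_mul //.
set a := q1.[z] * _; set b := q2.[z] * _ => hb ha.
have -> : q1.[z] * q2.[z] * (lval z l1 * lval z l2) - 1 =
    (a - 1) + (b - 1) + (a - 1) * (b - 1) by rewrite /a /b; ring.
apply: le_trans (cmodD _ _) _.
apply: le_trans (lerD (cmodD _ _) (lexx _)) _; rewrite cmodM.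
have := cmod_ge0 (a - 1); have := cmod_ge0 (b - 1).
move: (cmod _) (cmod (a - 1)) ha hb => u v hu hv u0 v0.
have : v * u <= v by rewrite ler_piMr //; lra.
lra.
Qed.

(** The inverse of [z - a] is expanded in powers of [z] or of [z^-1] according
    to the side of the annulus on which [a] lies. *)
Lemma invertible_factor (a : C) : ~ annulus r a -> invertible_on_circles ('X - a%:P).
Proof.
move=> ha eta eta0; have th0 : 0 <= s / r by rewrite divr_ge0 // ltW.
have th1 : s / r < 1 by rewrite ltr_pdivrMr // mul1r.
have [N hN] := expr_vanish th0 th1 eta0.
have bnd (u : C) : cmod u <= s / r -> cmod (- (u ^+ N)) <= eta.
  move=> hu; rewrite cmodN cmodX; apply: le_trans (hN N (leqnn _)).
  by rewrite lerXn2r ?nnegrE ?cmod_ge0.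
have geo (u : C) : (1 - u) * (\sum_(k < N) u ^+ k) - 1 = - u ^+ N.
  by rewrite -[u ^+ N](subrK 1) subrX1; ring.
have [ar|ar] := lerP r (cmod a).
  have a0 : a != 0 by rewrite -cmod_eq0 gt_eqF // (lt_le_trans r0).
  exists [seq (- a^-1 ^+ k.+1, k%:Z) | k <- iota 0 N] => z hz.
  rewrite hornerXsubC.
  have -> : lval z [seq (- a^-1 ^+ k.+1, k%:Z) | k <- iota 0 N] =
      - a^-1 * \sum_(k < N) (z / a) ^+ k.
    rewrite /lval big_map mulr_sumr -(big_mkord xpredT (fun k => _ * (z / a) ^+ k)).
    rewrite /index_iota subn0; apply: eq_bigr => k _ /=.
    by rewrite -exprnP exprMn exprS; ring.
  have -> : (z - a) * (- a^-1 * \sum_(k < N) (z / a) ^+ k) =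
      (1 - z / a) * (\sum_(k < N) (z / a) ^+ k) by field.
  rewrite geo; apply: bnd; rewrite cmodM cmodV.
  have zs : cmod z <= s.
    by case: hz => -> //; apply: le_trans (ltW s1); rewrite invf_le1 // ltW.
  apply: ler_pM; rewrite ?cmod_ge0 ?invr_ge0 ?cmod_ge0 //.
  by rewrite lef_pV2 // posrE // (lt_le_trans r0).
have {}ar : cmod a <= r^-1.
  by rewrite leNgt; apply/negP => h; apply: ha; rewrite annulusE h ar.
exists [seq (a ^+ k, - (k.+1)%:Z) | k <- iota 0 N] => z hz.
have z0 := circle_neq0 s1 hz.
rewrite hornerXsubC.
have -> : lval z [seq (a ^+ k, - (k.+1)%:Z) | k <- iota 0 N] =
    z^-1 * \sum_(k < N) (a / z) ^+ k.
  rewrite /lval big_map mulr_sumr -(big_mkord xpredT (fun k => _ * (a / z) ^+ k)).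
  rewrite /index_iota subn0; apply: eq_bigr => k _ /=.
  by rewrite -exprz_inv -exprnP exprMn exprS; ring.
have -> : (z - a) * (z^-1 * \sum_(k < N) (a / z) ^+ k) =
    (1 - a / z) * (\sum_(k < N) (a / z) ^+ k) by field.
rewrite geo; apply: bnd; rewrite cmodM cmodV mulrC.
apply: ler_pM; rewrite ?cmod_ge0 ?invr_ge0 ?cmod_ge0 //.
case: hz => ->; last by rewrite invrK.
by apply: le_trans (ltW s1); rewrite invf_le1 // ltW.
Qed.

Lemma invertible_annulus (q : {poly C}) :
  (forall z, annulus r z -> q.[z] != 0) -> invertible_on_circles q.
Proof.
move=> hq; have sA : annulus r s%:C.
  by apply: circle_annulus; left; rewrite cmodR gtr0_norm.
have q0 : q != 0 by apply: contraNneq (hq _ sA) => ->; rewrite horner0.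
have [rs qE] := closed_field_poly_normal q.
have : forall a, a \in rs -> ~ annulus r a.
  move=> a ars /hq /negP; apply; rewrite qE hornerZ mulf_eq0; apply/orP; right.
  by rewrite -[_ == 0]/(root _ a) root_prod_XsubC.
rewrite qE -mul_polyC => hrs; apply: invertible_mul.
  by apply: invertible_const; rewrite lead_coef_eq0.
elim: rs {qE} hrs => [|a rs IH] hrs.
  by rewrite big_nil; apply: invertible_const; rewrite oner_eq0.
rewrite big_cons; apply: invertible_mul.
  by apply: invertible_factor; apply: hrs; rewrite mem_head.
by apply: IH => b bs; apply: hrs; rewrite inE bs orbT.
Qed.

Definition lpoly (p : {poly C}) : laurent :=
  [seq (p`_k, k%:Z) | k <- iota 0 (size p)].

Lemma lval_poly (z : C) p : lval z (lpoly p) = p.[z].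
Proof.
rewrite /lval big_map horner_coef -(big_mkord xpredT (fun k => p`_k * z ^+ k)).
by rewrite /index_iota subn0.
Qed.

Lemma lev_poly d (A : 'M[C]_d.+1) p : lev A (lpoly p) = horner_mx A p.
Proof.
rewrite -[in RHS](coefK p) poly_def linear_sum /lev big_map.
rewrite -(big_mkord xpredT (fun k => horner_mx A (p`_k *: 'X^k))).
rewrite /index_iota subn0; apply: eq_bigr => k _ /=.
by rewrite linearZ /= rmorphXn /= horner_mx_X.
Qed.

Section Operator.
Variables (d : nat) (A : 'M[C]_d.+1).
Hypotheses (uA : A \is a GRing.unit) (As : mnorm A < s) (Ais : mnorm A^-1 < s).

(** If [l] is an approximate inverse of [q], then [p l] is a Laurent polynomial
    bounded by [1 + eta] on the circles, and its value at [A] differs from that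
    of [p / q] by the latter times a small matrix; [q(A)] is invertible because
    [q(A) l(A)] is close to [1]. *)
Lemma mnorm_ratfun_le p q : ratfun_bounded_by1 r p q ->
  mnorm (ratfun_mx p q A) <= Klaurent s A.
Proof.
move=> hpq; set K := Klaurent s A; have K0 : 0 <= K by exact: K_ge0.
pose F := ratfun_mx p q A; have F0 : 0 <= mnorm F := mnorm_ge0 _.
have step eta : 0 < eta -> K * eta < 1 -> mnorm F <= K * (1 + eta) + mnorm F * (K * eta).
  move=> eta0 eta1.
  have [l hl] := invertible_annulus (fun z hz => (hpq z hz).1) eta0.
  pose e := lmul (lpoly q) l ++ lconst (-1).
  have he : bounded_on_circles s e eta.
    move=> z hz; rewrite lval_cat lval_const lval_mul ?(circle_neq0 s1) // lval_poly.
    exact: hl.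
  have hE : mnorm (lev A e) <= K * eta by apply: mnorm_lev_le.
  have hh : mnorm (lev A (lmul (lpoly p) l)) <= K * (1 + eta).
    apply: mnorm_lev_le => //; first by rewrite ltr_wpDl.
    move=> z hz; rewrite lval_mul ?(circle_neq0 s1) // lval_poly.
    have [qz pq] := hpq z (circle_annulus hz).
    have -> : p.[z] * lval z l = (p.[z] / q.[z]) * (1 + (q.[z] * lval z l - 1)).
      by field.
    rewrite cmodM -[leRHS]mul1r; apply: ler_pM; rewrite ?cmod_ge0 //.
      by rewrite cmod_le.
    by apply: le_trans (cmodD _ _) _; rewrite cmod1 lerD2l hl.
  have QE : horner_mx A q *m lev A l = 1 + lev A e.
    rewrite lev_cat lev_const lev_mul // lev_poly scaleN1r addrCA addrN addr0.
    by [].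
  have Qu : horner_mx A q \in unitmx.
    have : horner_mx A q *m lev A l \in unitmx.
      apply: unitmx_near1; rewrite QE addrC addKr.
      exact: le_lt_trans hE _.
    by rewrite unitmx_mul => /andP[].
  have FE : lev A (lmul (lpoly p) l) = F + F *m lev A e.
    rewrite lev_mul // lev_poly -{1}[F]mulmx1 -mulmxDr -[1%:M + _]QE.
    by rewrite mulmxA /F /ratfun_mx mulmxKV.
  rewrite -{1}(addrK (F *m lev A e) F) -FE.
  apply: le_trans (mnormB _ _) _; apply: lerD => //.
  by apply: le_trans (mnormM _ _) _; rewrite ler_wpM2l.
apply/ler_addgt0Pr => e e0; set k := mnorm F in F0 step *.
pose c := K + k * K + 1.
have kK : 0 <= k * K by rewrite mulr_ge0.
have c0 : 0 < c by rewrite /c; lra.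
pose e' := Num.min e (1 / 2).
have e'0 : 0 < e' by rewrite lt_min e0; lra.
have [e'e e'1] : e' <= e /\ e' <= 1 / 2 by rewrite !ge_min !lexx orbT.
pose eta := e' / c.
have eta0 : 0 < eta by rewrite divr_gt0.
have : c * eta = e' by rewrite mulrC divfK // gt_eqF.
rewrite /c => etaE; have kKe : 0 <= k * K * eta by rewrite mulr_ge0 // ltW.
have Ke : 0 <= K * eta by rewrite mulr_ge0 // ltW.
have := step eta eta0 (ltac:(lra)); lra.
Qed.

End Operator.
End RationalFunctions.

Theorem mainTheorem1 (R : realType) (r : R) (d : nat) (A : 'M[R[i]]_d.+1)
    (r_gt1 : 1 < r) (A_unit : A \in unitmx)
    (A_lt : opnorm A < r) (Ainv_lt : opnorm (invmx A) < r) :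
  (Kconst A r <= (1 + Num.sqrt (1 + 2 / (r ^+ 2 + 1)))%:E)%E.
Proof.
apply: ereal_inf_lbound; exists (1 + Num.sqrt (1 + 2 / (r ^+ 2 + 1))) => //.
have opE (B : 'M[R[i]]_d.+1) : opnorm B = mnorm B by rewrite unlock.
move=> p q hpq; rewrite opE; rewrite !opE in A_lt Ainv_lt.
set k := mnorm _; rewrite leNgt; apply/negP => hk.
have r2 : 0 < r ^+ 2 + 1 by rewrite ltr_wpDl // sqr_ge0.
pose x := 2 / (r ^+ 2 + 1); have x0 : 0 < x by rewrite divr_gt0.
have sq : Num.sqrt (1 + x) ^+ 2 = 1 + x by rewrite sqr_sqrtr // addr_ge0 // ltW.
have sq1 : 1 < Num.sqrt (1 + x) 
  by rewrite -[ltLHS]sqrtr1 ltr_sqrt ?ltrDl ?addr_gt0.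
have k2 : 2 < k by move: hk; rewrite -/x; lra.
have kx : x < k * (k - 2).
  move: hk sq sq1; rewrite -/x; move: (Num.sqrt _) => u hk sq sq1; nra.
pose D := k * (k - 2) * (r ^+ 2 + 1) - 2.
have D0 : 0 < D by rewrite subr_gt0 -ltr_pdivrMr.
pose m := Num.max 1 (Num.max (mnorm A) (mnorm (invmx A))).
have mr : m < r by rewrite !gt_max r_gt1 A_lt.
have c0 : 0 < 4 * (k * (k - 2)) * r by rewrite !mulr_gt0 //; lra.
(* The first bound keeps [s] above [1] and both norms; the second makes [s] so
   close to [r] that [k (k - 2) (s^2 + 1)] still exceeds [2]. *)
pose s := Num.max ((m + r) / 2) (r - D / (4 * (k * (k - 2)) * r)).
have sr : s < r.
  by rewrite gt_max; apply/andP; split; [lra|rewrite ltrBlDr ltrDl divr_gt0].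
have ms : m < s by rewrite lt_max; apply/orP; left; lra.
have sD : (r - s) * (4 * (k * (k - 2)) * r) <= D.
  by rewrite -ler_pdivlMr // lerBlDr -lerBlDl le_max lexx orbT.
clearbody s; move: ms; rewrite !gt_max => /and3P[s1 As Ais].
have h := mnorm_ratfun_le s1 sr A_unit As Ais hpq.
have hK := Klaurent_quadratic s1 A_unit As Ais.
rewrite -/k in h; move: (Klaurent s A) h hK => K kK hK.
have s2 : 0 < s ^+ 2 + 1 by rewrite ltr_wpDl // sqr_ge0.
have gE : gap (s ^- 2) = 2 / (s ^+ 2 + 1).
  rewrite /gap; field; rewrite !gt_eqF ?exprn_gt0 //; lra.
have : k * (k - 2) * (s ^+ 2 + 1) <= 2.
  rewrite -ler_pdivlMr // -gE; apply: le_trans hK; apply: ler_pM => //; lra.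
apply/negP; rewrite -ltNge -subr_gt0.
have -> : k * (k - 2) * (s ^+ 2 + 1) - 2 =
  D - k * (k - 2) * ((r - s) * (r + s)) by rewrite /D; ring.
have b : (r - s) * (r + s) <= (r - s) * (2 * r) by rewrite ler_wpM2l //; lra.
have : k * (k - 2) * ((r - s) * (r + s)) <= k * (k - 2) * ((r - s) * (2 * r)).
  by rewrite ler_wpM2l // mulr_ge0 //; lra.
lra.
Qed.
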